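(* Let $G$ be a $3$-connected cubic plane bipartite graph whose faces are properly $3$-colored with color set $\{1,2,3\}$, and such that the outer face of $G$ is a $3$-face. Then the following statements are equivalent: (i) $G$ has a hamiltonian cycle $C$ such that all $2$-faces lie inside $C$, all $3$-faces lie outside $C$, and the $1$-faces lie on either side; (ii) the reduced graph $H$ obtained from $G$ by contracting each $1$-face to a single vertex has an $A$-trail; (iii) the reduced graph $H'$ obtained from $G$ by contracting each $2$-face to a single vertex has a spanning tree of faces consisting of $1$-faces (i.e. faces of $H'$ coming from $1$-faces of $G$); (iv) the reduced graph $H''$ obtained from $G$ by contracting each $3$-face to a single vertex has a spanning tree of faces consisting of $1$-faces.
   Context: A proper face-coloring assigns different colors to faces sharing an edge; faces of color $x$ are called $x$-faces. The faces of each color class form a facial $2$-factor, and contracting each face of one color class to a vertex yields a plane eulerian (multi)graph. An $A$-trail in a plane eulerian graph is an eulerian trail such that, whenever $e_i,e_j$ are consecutive edges of the trail at a vertex $v$ and $\langle e_1,\dots,e_{\deg(v)}\rangle$ is the counterclockwise cyclic ordering of the edges at $v$, then $j=i\pm1 \pmod{\deg(v)}$. For a $2$-connected plane graph $H$, the radial graph $\mathcal{R}(H)$ is the bipartite graph on $V(H)\cup\mathcal{F}(H)$ ($\mathcal{F}(H)$ the set of faces) with $x\sim f$ iff $x$ lies on the boundary of $f$; for a set $\mathcal{T}$ of bounded faces, $\mathcal{T}$ is a spanning tree of faces if the subgraph of $\mathcal{R}(H)$ induced by $V(H)\cup\mathcal{T}$ is a tree. *)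

(* Defs.v *)
(* Plane graphs are represented as combinatorial maps
   (rotation systems) on a finite type of darts (half-edges). *)
From mathcomp Require Import all_boot.
Set Implicit Arguments. Unset Strict Implicit. Unset Printing Implicit Defensive.

Section Maps.
Variable D : finType.
(* a : edge involution (the two half-edges of an edge);
   n : counterclockwise rotation of the half-edges around their vertex.
   Faces are the orbits of the face permutation  fstep x = n (a x). *)
Variables (a n : D -> D).

Definition fstep (x : D) : D := n (a x).

Definition vorb (x : D) : {set D} := [set y | fconnect n x y].
Definition forb (x : D) : {set D} := [set y | fconnect fstep x y].

Definition nvertices := #|[set vorb x | x : D]|.
Definition nfaces := #|[set forb x | x : D]|.
Definition nedges := #|D| %/ 2.

Definition is_map :=
  [/\ forall x, a (a x) = x, forall x, a x != x, injective n &
      forall x y, connect (fun p q => (q == a p) || (q == n p)) x y].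

(* genus 0 : Euler's formula V - E + F = 2 *)
Definition is_plane := nvertices + nfaces = nedges + 2.

Definition is_cubic := forall x, n (n (n x)) = x /\ n x != x.

Definition is_simple :=
  (forall x, ~~ fconnect n x (a x)) /\
  (forall x y, x != y -> fconnect n x y -> ~~ fconnect n (a x) (a y)).

Definition three_connected :=
  3 < nvertices /\
  forall u1 u2 : D,
    let S := vorb u1 :|: vorb u2 in
    forall x y, x \notin S -> y \notin S ->
      connect (fun p q => [&& p \notin S, q \notin S & (q == a p) || (q == n p)]) x y.

Definition is_bipartite :=
  exists b : D -> bool, forall x, b (n x) = b x /\ b (a x) != b x.

(* proper face 3-colouring with colours {1,2,3}; col x is the colour of
   the face containing dart x; the edge of x separates the faces of x and a x *)
Definition proper_face_3col (col : D -> nat) :=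
  forall x, [/\ 1 <= col x <= 3, col (fstep x) = col x & col (a x) != col x].

(* C is the set of darts of the edges of the cycle *)
Definition ham_cycle (C : {set D}) :=
  [/\ forall x, (a x \in C) = (x \in C),
      forall x, #|[set y in C | fconnect n x y]| = 2 &
      forall x y, connect (fun p q => ((p \in C) && (q == a p)) || (q == n p)) x y].

(* face of y is on the same side of C as the face of x: reachable in the dual
   graph without crossing edges of C *)
Definition same_side (C : {set D}) (x y : D) :=
  connect (fun p q => ((p \notin C) && (q == a p)) || (q == fstep p)) x y.

(* od is a dart of the outer face *)
Definition good_ham_cycle (col : D -> nat) (od : D) (C : {set D}) :=
  ham_cycle C /\
  forall x, (col x = 2 -> ~~ same_side C od x) /\ (col x = 3 -> same_side C od x).

Section Contract.
Variables (col : D -> nat) (c : nat).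

(* darts of the reduced graph: those whose edge is on no c-face *)
Definition kept (x : D) : bool := (col x != c) && (col (a x) != c).

(* rotation of the reduced graph: turn around the vertex, and when reaching
   a contracted c-face follow its boundary to the next vertex *)
Definition ncon (x : D) : D :=
  let s := traject fstep (n x) #|D| in nth x s (find kept s).

Definition cvert (x : D) : {set D} := [set y | fconnect ncon x y].
Definition cface (x : D) : {set D} := [set y | fconnect (fun z => ncon (a z)) x y].
Definition cvertices : {set {set D}} := [set cvert x | x in kept].
Definition cfaces : {set {set D}} := [set cface x | x in kept].

(* A-trail: closed eulerian trail (sequence of departing darts) such that
   consecutive edges at each vertex are consecutive in the rotation *)
Definition A_trail (s : seq D) :=
  [/\ all kept s,
      forall x, kept x -> count_mem x s + count_mem (a x) s = 1 &
      cycle (fun x y => (y == ncon (a x)) || (a x == ncon y)) s].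

(* radial graph: vertices inl X (X a vertex), faces inr F *)
Definition radj (u w : {set D} + {set D}) : bool :=
  match u, w with
  | inl X, inr F => X :&: F != set0
  | inr F, inl X => X :&: F != set0
  | _, _ => false
  end.

Definition is_tree (T : finType) (W : {set T}) (r : rel T) :=
  let rW := fun u w => [&& u \in W, w \in W & r u w] in
  (forall u w, u \in W -> w \in W -> connect rW u w) /\
  (forall s : seq T, uniq s -> 2 < size s -> ~~ cycle rW s).

Definition spanning_tree_of_faces (T : {set {set D}}) :=
  T \subset cfaces /\
  is_tree ([set inl X | X in cvertices] :|: [set inr F | F in T]) radj.

End Contract.

Definition from_1face (col : D -> nat) (F : {set D}) := forall x, x \in F -> col x = 1.

End Maps.

(* Main.v *)
Require Import Defs.
From mathcomp Require Import fingroup perm.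
From mathcomp Require Import all_boot.
From mathcomp Require Import zify.
Set Implicit Arguments. Unset Strict Implicit. Unset Printing Implicit Defensive.

(** A cycle as in (i) bounds the union [I] of the faces inside it, a union of
    faces containing all 2-faces and no 3-face.  Conversely the boundary of such
    a union always has two edges at each vertex, so (i) asks for an [I] with
    connected boundary; its complement serves the same purpose with the colours
    2 and 3 exchanged.  The 2-3 edges all lie on the boundary, and the 1-faces
    decide how the walk along it turns at each contracted 1-face: this is an
    A-trail.  The faces in [I] and their 1-2 edges form a graph, and so do the
    faces outside with their 1-3 edges.  If the boundary is connected, so are
    both graphs, and Euler's formula gives their Euler characteristics the sum
    2; hence both are trees.  If conversely the graph inside is a tree, Euler's
    inequality for its ribbon graph leaves room for one boundary component only.
    The radial graphs record adjacency without multiplicity, which is harmless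
    because two faces of a 3-connected plane graph share at most one edge. *)

(** * Components of finite relations *)

(** In a combinatorial map planarity is nothing but the equation V - E + F = 2, so the sides of a
    cycle cannot be had from a curve in the plane; replacing the cycle by a union of faces turns
    every topological claim into a count. The tool for these counts is Euler's inequality for an
    arbitrary pair of permutations. It serves twice: for the inner faces glued along their common
    edges, where it bounds the number of boundary walks, and for the map with two edges deleted,
    where it forces a disconnection. Everything else is local. The three faces at a vertex have
    three different colours, so each vertex lies on exactly one edge of each kind, and two faces
    that meet at a vertex share an edge there. The colours 2 and 3 are variables [p] and [q] because
    an A-trail may traverse its edges in either direction and because (iv) is (iii) read from the
    other side of the boundary. *)

Lemma connect_ind (T : finType) (e : rel T) (P : T -> Prop) x y :
  (forall u v, e u v -> P u -> P v) -> connect e x y -> P x -> P y.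
Proof.
move=> eP /connectP[s]; elim: s x => [|z s IH] x /=; first by move=> _ ->.
by case/andP=> exz ps ly Px; apply: IH ps ly (eP _ _ exz Px).
Qed.

Definition comp_of (T : finType) (e : rel T) x : {set T} := [set y | connect e x y].

Definition ncomp (T : finType) (e : rel T) := #|[set comp_of e x | x : T]|.

Lemma comp_of_refl (T : finType) (e : rel T) x : x \in comp_of e x.
Proof. by rewrite inE connect0. Qed.

Lemma comp_of_eqE (T : finType) (e : rel T) : connect_sym e ->
  forall x y, (comp_of e x == comp_of e y) = connect e x y.
Proof.
move=> sym x y; apply/eqP/idP => [/setP/(_ y)|cxy]; first by rewrite !inE connect0.
by apply/setP=> z; rewrite !inE; apply: same_connect.
Qed.

Lemma eq_ncomp (T : finType) (e e' : rel T) :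
  connect e =2 connect e' -> ncomp e = ncomp e'.
Proof.
move=> ee'; rewrite /ncomp; congr #|pred_of_set _|; apply: eq_imset => x.
by apply/setP=> y; rewrite !inE ee'.
Qed.

Definition add_edge (T : finType) (e : rel T) (x y : T) : rel T :=
  fun u v => [|| e u v, (u == x) && (v == y) | (u == y) && (v == x)].

Lemma connect_add_edge (T : finType) (e : rel T) x y : connect_sym e ->
  forall u v, connect (add_edge e x y) u v =
    [|| connect e u v, connect e u x && connect e y v
      | connect e u y && connect e x v].
Proof.
move=> sym u v; have sub w z : connect e w z -> connect (add_edge e x y) w z.
  by apply: connect_sub => s t est; rewrite connect1 // /add_edge est.
have xy : connect (add_edge e x y) x y by rewrite connect1 // /add_edge !eqxx orbT.
have yx : connect (add_edge e x y) y x by rewrite connect1 // /add_edge !eqxx !orbT.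
apply/idP/idP; last first.
  case/or3P=> [/sub //|/andP[/sub ux /sub yv]|/andP[/sub uy /sub xv]].
    exact: connect_trans ux (connect_trans xy yv).
  exact: connect_trans uy (connect_trans yx xv).
move=> cuv.
apply: (connect_ind (P := fun v => [|| connect e u v, connect e u x && connect e y v
      | connect e u y && connect e x v]) _ cuv); last by rewrite connect0.
move=> s t /or3P[est|/andP[/eqP-> /eqP->]|/andP[/eqP-> /eqP->]].
- have cst := connect1 est.
  case/or3P=> [us|/andP[-> ys]|/andP[-> xs]].
  + by rewrite (connect_trans us cst).
  + by rewrite (connect_trans ys cst) orbT.
  + by rewrite (connect_trans xs cst) !orbT.
- by case/or3P=> [->|/andP[-> _]|/andP[-> _]]; rewrite !connect0 ?orbT.
- by case/or3P=> [->|/andP[-> _]|/andP[-> _]]; rewrite !connect0 ?orbT.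
Qed.

Lemma add_edge_csym (T : finType) (e : rel T) x y :
  connect_sym e -> connect_sym (add_edge e x y).
Proof.
move=> sym u v; rewrite !connect_add_edge // (sym v u) (sym v x) (sym v y).
rewrite (sym y u) (sym x u) [connect e x v && _]andbC [connect e y v && _]andbC.
by rewrite [X in _ = _ || X]orbC.
Qed.

Lemma ncomp_add_edge (T : finType) (e : rel T) x y : connect_sym e ->
  ncomp (add_edge e x y) + ~~ connect e x y = ncomp e.
Proof.
move=> sym; have cE := connect_add_edge x y sym.
case: (boolP (connect e x y)) => [cxy|ncxy] /=.
  rewrite addn0; apply: eq_ncomp => u v; rewrite cE.
  apply/or3P/idP=> [[//|/andP[ux yv]|/andP[uy xv]]|->]; last by constructor 1.
    exact: connect_trans ux (connect_trans cxy yv).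
  by apply: connect_trans uy (connect_trans _ xv); rewrite sym.
pose X := comp_of e x; pose Y := comp_of e y.
pose K := [set comp_of e z | z : T].
have neXY : X != Y by rewrite comp_of_eqE.
have KX : X \in K by apply: imset_f.
have KY : Y \in K by apply: imset_f.
have KXY : X :|: Y \notin K.
  apply/imsetP=> -[z _ XYz]; case/negP: ncxy.
  have : x \in X :|: Y by rewrite inE comp_of_refl.
  have : y \in X :|: Y by rewrite inE comp_of_refl orbT.
  rewrite XYz !inE => zy zx; apply: connect_trans zy; by rewrite sym.
have nzE z : z \notin X :|: Y -> comp_of (add_edge e x y) z = comp_of e z.
  rewrite !inE negb_or ![connect e _ z]sym => /andP[zx zy].
  by apply/setP=> w; rewrite !inE cE (negPf zx) (negPf zy) !orbF.
have zE z : z \in X :|: Y -> comp_of (add_edge e x y) z = X :|: Y.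
  rewrite !inE ![connect e _ z]sym => zxy; apply/setP=> w; rewrite !inE cE.
  case/orP: zxy => [zx|zy].
    rewrite zx (same_connect sym zx w); case: (boolP (connect e x w)) => //= _.
    by rewrite andbF orbF.
  rewrite zy (same_connect sym zy w); case: (boolP (connect e y w)) => //= _.
    by rewrite orbT.
  by rewrite andbF orbF.
have defK : [set comp_of (add_edge e x y) z | z : T] = (X :|: Y) |: (K :\ X :\ Y).
  apply/setP=> A; rewrite !inE; apply/imsetP/idP => [[z _ ->]|].
    case: (boolP (z \in X :|: Y)) => zXY; first by rewrite zE ?eqxx.
    rewrite nzE // imset_f // andbT orbC.
    move: zXY; rewrite !inE negb_or => /andP[xz yz].
    by rewrite !comp_of_eqE // ![connect e z _]sym xz yz.
  case/orP=> [/eqP->|/and3P[AY AX /imsetP[z _ Az]]].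
    by exists x => //; rewrite zE // inE comp_of_refl.
  exists z => //; rewrite nzE -?Az // !inE negb_or ![connect e _ z]sym.
  by rewrite -!comp_of_eqE // -Az AX AY.
rewrite /ncomp defK cardsU1 !inE (negPf KXY) !andbF /=.
rewrite (cardsD1 X K) KX (cardsD1 Y (K :\ X)) !inE eq_sym neXY KY /=; lia.
Qed.

Lemma card_imset_eq_fibers (T U U' : finType) (A : {pred T}) (f : T -> U) (g : T -> U') :
  {in A &, forall x y, (f x == f y) = (g x == g y)} ->
  #|[set f x | x in A]| = #|[set g x | x in A]|.
Proof.
suff half (V V' : finType) (h : T -> V) (k : T -> V') :
    {in A &, forall x y, k x = k y -> h x = h y} ->
    #|[set h x | x in A]| <= #|[set k x | x in A]|.
  move=> fg; apply/eqP; rewrite eqn_leq !half // => x y Ax Ay /eqP E; apply/eqP.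
    by rewrite -fg.
  by rewrite fg.
move=> kh; case: (pickP [in A]) => [x0 Ax0|A0]; last first.
  rewrite (_ : [set h x | x in A] = set0) ?cards0 //; apply/setP=> v; rewrite inE.
  by apply/imsetP=> -[x Ax]; have := A0 x; rewrite /= Ax.
pose pk v := odflt x0 [pick x in A | k x == v].
apply: leq_trans (leq_imset_card (h \o pk) _); apply: subset_leq_card.
apply/subsetP=> _ /imsetP[x Ax ->]; apply/imsetP; exists (k x); first exact: imset_f.
rewrite /= /pk; case: pickP => [y /andP[Ay /eqP kyx]|/(_ x)]; first exact: kh.
by rewrite Ax eqxx.
Qed.

(** Restricts a global count to [I]: the graphs and permutations below live on a whole type and are
    trivial outside the part that matters. *)
Lemma card_classes_split (T : finType) (cl : T -> {set T}) (I : pred T) :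
  (forall x, x \in cl x) -> (forall x, ~~ I x -> cl x = [set x]) ->
  (forall x y, I x -> y \in cl x -> I y) ->
  #|[set cl x | x : T]| = #|[set cl x | x in I]| + #|[pred x | ~~ I x]|.
Proof.
move=> clx cl1 clI.
have -> : [set cl x | x : T] = [set cl x | x in I] :|: [set cl x | x in [pred x | ~~ I x]].
  apply/setP=> A; rewrite inE; apply/imsetP/orP=> [[x _ ->]|[]/imsetP[x _ ->]].
  - by case: (boolP (I x)) => Ix; [left|right]; apply: imset_f.
  - by exists x.
  - by exists x.
rewrite cardsU disjoint_setI0 ?cards0 ?subn0; last first.
  rewrite disjoint_subset; apply/subsetP=> _ /imsetP[x Ix ->]; rewrite inE.
  apply/imsetP=> -[y nIy E]; have := clI x y Ix; rewrite E clx => /(_ isT) Iy.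
  by rewrite inE Iy in nIy.
congr (_ + _); rewrite card_in_imset // => x y nx ny; rewrite !cl1 //.
by move/set1_inj.
Qed.

Lemma card_classes_uniform (T : finType) (cl : T -> {set T}) (I : {set T}) k :
  (forall x, x \in cl x) -> (forall x y, y \in cl x -> cl y = cl x) ->
  (forall x, x \in I -> cl x \subset I /\ #|cl x| = k) ->
  #|I| = #|[set cl x | x in I]| * k.
Proof.
move=> clx clE clI; apply: card_uniform_partition.
  by move=> _ /imsetP[x /clI[_ E] ->].
apply/and3P; split.
- apply/eqP/setP=> y; apply/bigcupP/idP=> [[_ /imsetP[x /clI[/subsetP sub _] ->]]|Iy].
    exact: sub.
  by exists (cl y); rewrite ?clx // imset_f.
- apply/trivIsetP=> _ _ /imsetP[x Ix ->] /imsetP[y Iy ->].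
  apply: contraNT => /pred0Pn[z /= /andP[zx zy]].
  by rewrite -(clE x z zx) -(clE y z zy).
- by apply/imsetP=> -[x _ E]; have := clx x; rewrite -E inE.
Qed.

(** * Counting edges of forests *)

Section Forest.
Variable U : finType.
Implicit Types (L : seq (U * U)) (u v : U).

Definition edge_rel L : rel U := fun u v => ((u, v) \in L) || ((v, u) \in L).

Definition acyclic (r : rel U) := forall s : seq U, uniq s -> 2 < size s -> ~~ cycle r s.

(** [edge_rel] symmetrises, so each edge is listed in one direction only; the case [u = v] also
    forbids loops. Thus [size L] counts the edges of a simple graph. *)
Definition oriented L :=
  uniq L /\ forall u v, (u, v) \in L -> (v, u) \notin L.

Lemma edge_rel_sym L : symmetric (edge_rel L).
Proof. by move=> u v; rewrite /edge_rel orbC. Qed.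

Lemma edge_rel_csym L : connect_sym (edge_rel L).
Proof. exact/sym_connect_sym/edge_rel_sym. Qed.

Lemma ncomp_edge_cons L e :
  ncomp (edge_rel (e :: L)) + ~~ connect (edge_rel L) e.1 e.2 = ncomp (edge_rel L).
Proof.
rewrite -(ncomp_add_edge e.1 e.2 (@edge_rel_csym L)); congr (_ + _).
apply: eq_ncomp; apply: eq_connect => u v.
case: e => x y; rewrite /edge_rel /add_edge !inE !xpair_eqE /=.
rewrite ![_ && (u == _)]andbC.
by case: (_ && _) => //=; rewrite ?orbT //; case: (_ && _); rewrite ?orbT ?orbF.
Qed.

Lemma ncomp_edge_nil : ncomp (edge_rel [::]) = #|U|.
Proof.
rewrite /ncomp card_imset // => x y /eqP; rewrite comp_of_eqE; last exact: edge_rel_csym.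
by move=> c; apply/esym; apply: (connect_ind (P := fun z => z = x) _ c).
Qed.

Lemma card_le_ncomp_edges L : #|U| <= ncomp (edge_rel L) + size L.
Proof.
elim: L => [|e L IH] /=; first by rewrite ncomp_edge_nil addn0.
apply: leq_trans IH _; rewrite -(ncomp_edge_cons L e); case: (~~ _); lia.
Qed.

Lemma acyclic_ncomp_edges L : oriented L -> acyclic (edge_rel L) ->
  #|U| = ncomp (edge_rel L) + size L.
Proof.
elim: L => [|[x y] L IH] [/= uL oL] aL; first by rewrite ncomp_edge_nil addn0.
case/andP: uL => nL uL.
have sub : subrel (edge_rel L) (edge_rel ((x, y) :: L)).
  by move=> u v; rewrite /edge_rel !inE => /orP[]->; rewrite ?orbT.
rewrite {}IH; last 2 first.
- by split=> // u v uv; have := oL u v; rewrite !inE uv orbT negb_or => /(_ isT)/andP[].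
- by move=> s us ss; apply: contra (aL s us ss); apply: sub_cycle.
rewrite -(ncomp_edge_cons L (x, y)) /=.
suff -> : connect (edge_rel L) x y = false by rewrite /=; lia.
apply/negP=> /connectP[p0 pp0 ly].
have nyx : (y, x) \notin (x, y) :: L by apply: oL; rewrite inE eqxx.
case/shortenP: pp0 ly => p pp up _ ly.
have := aL (x :: p) up; rewrite /= rcons_path (sub_path sub) // -ly.
rewrite /edge_rel mem_head orbT => H; suff /H : 2 < (size p).+1 by [].
(* A path of length 0 or 1 from [x] to [y] would make [(x, y)] a loop or a repeated edge. *)
case: p pp up ly {H} => [|z [|z' p]] //=.
  by move=> _ _ E; rewrite E inE eqxx in nyx.
move=> /andP[xz _] _ E; move: xz; rewrite -E /edge_rel (negPf nL) /=.
by move: nyx; rewrite inE negb_or => /andP[_ /negPf->].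
Qed.

(** An edge of a cycle can be removed without changing the components, and the shorter list would
    violate [card_le_ncomp_edges]. *)
Lemma ncomp_edges_acyclic L : oriented L ->
  #|U| = ncomp (edge_rel L) + size L -> acyclic (edge_rel L).
Proof.
move=> [uL oL] cL [|x0 [|x1 [|x2 s]]] // us _; apply/negP.
rewrite (cycle_path x0) => /=.
case/and4P=> lx e01 e12 pp.
have [e eL eE] : exists2 e, e \in L & e = (x0, x1) \/ e = (x1, x0).
  by case/orP: e01 => h; [exists (x0, x1)|exists (x1, x0)] => //; [left|right].
have keep u v : edge_rel L u v -> (u, v) != (x0, x1) -> (u, v) != (x1, x0) ->
    edge_rel (rem e L) u v.
  rewrite /edge_rel !mem_rem_uniq // !inE => uv n1 n2.
  have n1' : (v, u) != (x0, x1) by move: n2; rewrite !xpair_eqE andbC.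
  have n2' : (v, u) != (x1, x0) by move: n1; rewrite !xpair_eqE andbC.
  by case: eE uv => ->; rewrite ?n1 ?n2 ?n1' ?n2'.
have c01 : connect (edge_rel (rem e L)) e.1 e.2.
  suff c : connect (edge_rel (rem e L)) x1 x0.
    by case: eE => E; rewrite [in e.1]E [in e.2]E //= edge_rel_csym.
  case/andP: us; rewrite inE negb_or => /andP[n01 x0s] us.
  apply: (@connect_trans _ _ (last x1 (x2 :: s))).
    apply/connectP; exists (x2 :: s) => //.
    have h z w : z != x0 -> w != x0 -> edge_rel L z w -> edge_rel (rem e L) z w.
      by move=> nz nw zw; apply: keep => //; rewrite xpair_eqE negb_and ?nz // orbC nw.
    have : path (edge_rel L) x1 (x2 :: s) by rewrite /= e12.
    rewrite eq_sym in n01; elim: (x2 :: s) (x1) n01 x0s => //= v t IH u nu.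
    rewrite inE negb_or eq_sym => /andP[nv nt] /andP[uv pv].
    by rewrite h //= IH.
  apply: connect1; apply: keep => //=.
    rewrite xpair_eqE negb_and; apply/orP; left.
    by apply: contraNneq x0s => <-; apply: mem_last.
  rewrite xpair_eqE negb_and; apply/orP; left.
  by apply/eqP=> E; case/andP: us; rewrite -E mem_last.
have rL : L =i e :: rem e L by apply/perm_mem/perm_to_rem.
have cE : ncomp (edge_rel L) = ncomp (edge_rel (e :: rem e L)).
  by apply: eq_ncomp; apply: eq_connect => u v; rewrite /edge_rel -!rL.
have := ncomp_edge_cons (rem e L) e; rewrite c01 addn0 -cE => E.
have := card_le_ncomp_edges (rem e L); rewrite -E cL size_rem //.
have : 0 < size L by case: (L) eL.
by rewrite leq_add2l; case: (size L) => // k _; rewrite ltnn.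
Qed.

(** The points outside [W] are isolated, so there is one component more than there are such
    points. *)
Lemma tree_edge_count (W : {set U}) L :
  W != set0 -> oriented L ->
  (forall u v, edge_rel L u v -> u \in W /\ v \in W) ->
  {in W &, forall u v, connect (edge_rel L) u v} ->
  #|W| <= (size L).+1 /\ (acyclic (edge_rel L) <-> #|W| = (size L).+1).
Proof.
move=> /set0Pn[w Ww] oL LW cL.
have nE : ncomp (edge_rel L) + #|W| = #|U|.+1.
  rewrite /ncomp (card_classes_split (I := [in W])).
  - rewrite (_ : [set _ | x in _] = [set comp_of (edge_rel L) w]) ?cards1.
      rewrite (_ : #|_| = #|~: W|); first by rewrite -(cardsC W); lia.
      by apply: eq_card => x; rewrite !inE.
    apply/setP=> A; rewrite inE; apply/imsetP/eqP=> [[x Wx ->]|->]; last by exists w.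
    by apply/eqP; rewrite comp_of_eqE; [apply: cL|apply: edge_rel_csym].
  - exact: comp_of_refl.
  - move=> x nWx; apply/setP=> y; rewrite !inE; apply/idP/eqP=> [c|->]; last exact: connect0.
    apply: (connect_ind (P := fun z => z = x) _ c) => // u v uv E.
    by have [] := LW u v uv; rewrite E => Wx; case/negP: nWx.
  - move=> x y Wx; rewrite inE => c; apply: (connect_ind (P := [in W]) _ c) => //.
    by move=> u v /LW[].
have := card_le_ncomp_edges L; split; first lia.
split=> [aL|E]; first by have := acyclic_ncomp_edges oL aL; lia.
apply: ncomp_edges_acyclic => //; lia.
Qed.

End Forest.

(** * Euler's inequality for permutations *)

Section Euler.
Variable T : finType.
Implicit Types s t : {perm T}.

(** Its classes are the orbits of the group generated by [s] and [t], the components of a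
    hypermap. *)
Definition perm2_rel s t : rel T := fun x y => (y == s x) || (y == t x).

Lemma porbit_fconnect s x y : (y \in porbit s x) = fconnect s x y.
Proof.
apply/porbitP/idP=> [[i ->]|/iter_findex <-]; first by rewrite permX fconnect_iter.
by exists (findex s x y); rewrite permX.
Qed.

Lemma perm2_csym s t : connect_sym (perm2_rel s t).
Proof.
have half u v : connect (perm2_rel s t) u v -> connect (perm2_rel s t) v u.
  move=> c; apply: (connect_ind (P := fun v => connect (perm2_rel s t) v u) _ c);
    last exact: connect0.
  move=> w z /orP[]/eqP-> cw; apply: connect_trans cw.
    have : fconnect s (s w) w by rewrite fconnect_sym ?fconnect1 //; apply: perm_inj.
    by apply: connect_sub => x y /eqP <-; rewrite connect1 // /perm2_rel eqxx.
  have : fconnect t (t w) w by rewrite fconnect_sym ?fconnect1 //; apply: perm_inj.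
  by apply: connect_sub => x y /eqP <-; rewrite connect1 // /perm2_rel eqxx orbT.
by move=> u v; apply/idP/idP; apply: half.
Qed.

(** A transposition is its own inverse, so the orbit counts for [s] and for [tperm x y * s] together
    decide whether a cycle is cut or two cycles are joined. *)
Lemma porbit_mul_tperm_merge s x y :
  x \notin porbit s y -> y \in porbit (tperm x y * s) x.
Proof.
move=> nxy; have /= := porbits_mul_tperm s x y.
have /= := porbits_mul_tperm (tperm x y * s) x y.
rewrite mulgA tperm2 mul1g nxy porbit_sym => A B.
by apply/negPn/negP=> h; move: A B; rewrite h /=; case: (x != y) => /=; lia.
Qed.

Lemma porbit_mul_tperm_sub s x y : y \in porbit (tperm x y * s) x ->
  porbit s x \subset porbit (tperm x y * s) x.
Proof.
move=> yx; apply/subsetP=> z; rewrite porbit_fconnect => c.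
have step w : w \in porbit (tperm x y * s) x ->
    (tperm x y * s)%g w \in porbit (tperm x y * s) x.
  by move=> /porbitP[i ->]; rewrite -permM -expgSr mem_porbit.
apply: (connect_ind (P := fun z => z \in porbit (tperm x y * s) x) _ c);
  last exact: porbit_id.
move=> u v /eqP <- ux.
have -> : s u = (tperm x y * s)%g (tperm x y u) by rewrite permM tpermK.
by apply: step; case: tpermP => // _; rewrite ?porbit_id.
Qed.

Lemma ncomp_perm1 s : ncomp (perm2_rel s 1) = #|porbits s|.
Proof.
rewrite /ncomp /porbits; congr #|pred_of_set _|; apply: eq_imset => x.
apply/setP=> y; rewrite inE porbit_fconnect; apply/idP/idP; apply: connect_sub => u v.
  by case/orP=> /eqP->; rewrite ?perm1 ?connect0 // fconnect1.
by move=> /eqP <-; rewrite connect1 // /perm2_rel eqxx.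
Qed.

(* Induction on the support of [t]: cutting a fixed point out of a cycle of [t]
   multiplies both [t] and [t * s] by one transposition. *)
Lemma euler_inequality s t :
  #|porbits s| + #|porbits t| + #|porbits (t * s)| <= #|T| + (ncomp (perm2_rel s t)).*2.
Proof.
have [k] := ubnP #|[set z | t z != z]|; elim: k t => // k IH t; rewrite ltnS => tk.
have [t1|[x tx]] : t = 1%g \/ exists x, t x != x.
  case: (pickP (fun x => t x != x)) => [x tx|all]; first by right; exists x.
  by left; apply/perm.permP=> x; rewrite perm1; apply/eqP; have := all x; move/negbFE.
- rewrite t1 mul1g ncomp_perm1.
  have : #|porbits (1 : {perm T})| <= #|T| by rewrite /porbits leq_imset_card.
  lia.
pose y := t x; pose t' := (tperm x y * t)%g.
have t'y : t' y = y by rewrite permM tpermR.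
have t'x : t' x = t y by rewrite permM tpermL.
have t'z z : z != x -> z != y -> t' z = t z.
  by move=> zx zy; rewrite permM tpermD // eq_sym.
have ty : t y != y by rewrite (inj_eq perm_inj).
have supp : #|[set z | t' z != z]| < k.
  apply: leq_trans tk; apply: proper_card; apply/properP; split.
    apply/subsetP=> z; rewrite !inE; have [->|zx] := eqVneq z x; first by [].
    by have [->|zy] := eqVneq z y; rewrite ?t'y ?eqxx // t'z.
  by exists y; rewrite !inE ?ty // t'y eqxx.
have := IH _ supp.
have zt' : #|porbits t'| = #|porbits t|.+1.
  have /= := porbits_mul_tperm t x y; rewrite -/t' porbit_sym (mem_porbit t 1) eq_sym tx /=.
  lia.
have cE : ncomp (perm2_rel s t) + ~~ connect (perm2_rel s t') x y = ncomp (perm2_rel s t').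
  rewrite -(ncomp_add_edge x y (perm2_csym s t')); congr (_ + _); apply: eq_ncomp.
  have symA : connect_sym (add_edge (perm2_rel s t') x y) by apply/add_edge_csym/perm2_csym.
  have Cxy : connect (add_edge (perm2_rel s t') x y) x y.
    by rewrite connect1 // /add_edge !eqxx orbT.
  have Txy : connect (perm2_rel s t) x y by rewrite connect1 // /perm2_rel eqxx orbT.
  have Ct u : connect (add_edge (perm2_rel s t') x y) u (t' u).
    by rewrite connect1 // /add_edge /perm2_rel eqxx orbT.
  have Tt u : connect (perm2_rel s t) u (t u).
    by rewrite connect1 // /perm2_rel eqxx orbT.
  move=> u v; apply/idP/idP; apply: connect_sub => {}u {}v.
    case/orP=> /eqP->; first by rewrite connect1 // /add_edge /perm2_rel eqxx.
    have [->|ux] := eqVneq u x; first exact: Cxy.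
    have [->|uy] := eqVneq u y; last by rewrite -t'z.
    by rewrite -t'x; apply: connect_trans (Ct x); rewrite symA.
  case/or3P=> [/orP[]/eqP->|/andP[/eqP-> /eqP->]|/andP[/eqP-> /eqP->]] //.
  - by rewrite connect1 // /perm2_rel eqxx.
  - have [->|ux] := eqVneq u x; first by rewrite t'x; apply: connect_trans (Tt y).
    by have [->|uy] := eqVneq u y; rewrite ?t'y ?connect0 // t'z.
  - by rewrite perm2_csym.
have /= zE := porbits_mul_tperm (t * s) x y; rewrite mulgA -/t' eq_sym tx /= in zE.
(* If [x] and [y] share a cycle of [t * s], passing to [t'] cuts it, which pays for a component that
   may split off. Otherwise two cycles are joined, so [x] and [y] stay connected and no component is
   gained. *)
case: (boolP (x \in porbit (t * s) y)) zE => [_|nxy] zE.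
  move: cE zE zt'; case: (~~ _); move: #|porbits t'| #|porbits (t' * s)| => z1 z2 /=;
    move: (ncomp (perm2_rel s t')) => c'; lia.
suff cxy : connect (perm2_rel s t') x y.
  move: cE zE zt'; rewrite cxy; move: #|porbits t'| #|porbits (t' * s)| => z1 z2 /=.
  by move: (ncomp (perm2_rel s t')) => c'; lia.
have : y \in porbit (t' * s) x by rewrite -mulgA; apply: porbit_mul_tperm_merge.
rewrite porbit_fconnect; apply: connect_sub => u v /eqP <-; rewrite permM.
apply: (@connect_trans _ _ (t' u)); rewrite connect1 // /perm2_rel eqxx ?orbT //.
Qed.

Lemma porbit_invol t x : t (t x) = x -> porbit t x = [set x; t x].
Proof.
move=> ttx; apply/setP=> y; rewrite !inE porbit_fconnect; apply/idP/orP=> [c|].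
  apply: (connect_ind (P := fun y => y == x \/ y == t x) _ c); last by left.
  by move=> u v /eqP<- [/eqP->|/eqP->]; rewrite ?ttx eqxx; [right|left].
by case=> /eqP->; rewrite ?connect0 ?fconnect1.
Qed.

Lemma card_porbits_invol t : (forall x, t (t x) = x) ->
  #|porbits t|.*2 + #|[set x | t x != x]| = #|T|.*2.
Proof.
move=> ttK; pose M := [set x | t x != x].
have clx x : x \in porbit t x by exact: porbit_id.
have clM x y : x \in M -> y \in porbit t x -> y \in M.
  by rewrite porbit_invol // !inE => Mx /orP[]/eqP-> //; rewrite ttK eq_sym.
have E1 : #|porbits t| = #|[set porbit t x | x in M]| + #|~: M|.
  rewrite /porbits (card_classes_split (I := [in M]) clx).
  - by congr (_ + _); apply: eq_card => x; rewrite !inE.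
  - move=> x; rewrite inE negbK => /eqP E; rewrite porbit_invol // E; exact: setUid.
  - by move=> x y; apply: clM.
have E2 : #|M| = #|[set porbit t x | x in M]| * 2.
  apply: card_classes_uniform => // x.
    by move=> y yx; apply/eqP; rewrite eq_porbit_mem.
  move=> Mx; split; first by apply/subsetP=> y; apply: clM.
  by rewrite porbit_invol // cards2 eq_sym; move: Mx; rewrite inE => ->.
rewrite -(cardsC M) -/M E1; move: E2; move: #|M| #|~: M| => m m'.
by move: #|[set porbit t x | x in M]| => k; lia.
Qed.

End Euler.

(** * Face-coloured cubic maps *)

Section ColouredMap.
Variables (D : finType) (a n : D -> D) (col : D -> nat) (p q : nat).
Hypothesis aK : forall x, a (a x) = x.
Hypothesis n3 : forall x, n (n (n x)) = x.
Hypothesis col_face : forall x, col (fstep a n x) = col x.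
Hypothesis col_edge : forall x, col (a x) != col x.
Hypothesis col_cases : forall x, [|| col x == 1, col x == p | col x == q].
Hypothesis col_neq : [&& p != 1, q != 1 & p != q].

Local Notation f := (fstep a n).

Lemma a_inj : injective a. Proof. exact: can_inj aK. Qed.

Lemma n_inj : injective n.
Proof. by move=> x y E; rewrite -(n3 x) E n3. Qed.

Lemma f_inj : injective f.
Proof. by move=> x y /n_inj/a_inj. Qed.

Lemma f_a x : f (a x) = n x. Proof. by rewrite /fstep aK. Qed.

(** The edge of [x] separates the faces of [x] and [n x], and [n (n x)] is on the third face at the
    vertex. This makes all colour computations local. *)
Lemma col_n x : col (n x) = col (a x).
Proof. by rewrite -f_a col_face. Qed.

Lemma col_vertex x : [&& col (n x) != col x, col (n (n x)) != col (n x)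
  & col (n (n x)) != col x].
Proof.
rewrite [col (n x)]col_n col_edge -col_n [col (n (n x))]col_n col_edge -col_n /=.
by rewrite -[in X in _ != X](n3 x) [col (n (n (n x)))]col_n eq_sym col_edge.
Qed.

Variant vertex_col_spec : nat -> nat -> nat -> Prop :=
  | VertexCol1pq : vertex_col_spec 1 p q
  | VertexCol1qp : vertex_col_spec 1 q p
  | VertexColp1q : vertex_col_spec p 1 q
  | VertexColpq1 : vertex_col_spec p q 1
  | VertexColq1p : vertex_col_spec q 1 p
  | VertexColqp1 : vertex_col_spec q p 1.

Lemma vertex_colP x : vertex_col_spec (col x) (col (n x)) (col (n (n x))).
Proof.
move: (col_vertex x) (col_cases x) (col_cases (n x)) (col_cases (n (n x))).
move: (col x) (col (n x)) (col (n (n x))) => i j k + hi hj hk.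
by case/or3P: hi => /eqP->; case/or3P: hj => /eqP->; case/or3P: hk => /eqP->;
  rewrite ?eqxx ?andbF // => _; constructor.
Qed.

Lemma colF : ((p == 1 = false) * (q == 1 = false) * (p == q = false) *
  (1 == p = false) * (1 == q = false) * (q == p = false))%type.
Proof.
case/and3P: col_neq => /negPf p1 /negPf q1 /negPf pq.
by rewrite ![1 == _]eq_sym p1 q1 [q == p]eq_sym pq.
Qed.

Ltac colour_cases := first [done | intros; exfalso;
  match goal with H : _ = _ |- _ => by move/eqP: H; rewrite colF end].

(** An edge survives the contraction of the [c]-faces when the face opposite to it at its end has
    colour [c]. *)
Lemma kept_col c x : [|| c == 1, c == p | c == q] ->
  kept a col c x = (col (n (n x)) == c).
Proof.
by rewrite /kept -col_n => /or3P[]/eqP->; case: (vertex_colP x); rewrite ?colF ?eqxx.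
Qed.

Lemma nconE c x : [|| c == 1, c == p | c == q] -> kept a col c x ->
  ncon a n col c x = n (a (n x)).
Proof.
move=> cE kx; have D2 : 1 < #|D|.
  apply: leq_trans (max_card [in [:: x; a x]]).
  rewrite (card_uniqP _) //= andbT inE; apply/eqP=> E.
  by have := col_edge x; rewrite -E eqxx.
rewrite /ncon; case: #|D| D2 => [|[|k]] //= _.
rewrite !kept_col //= in kx *.
rewrite n3 -[col (n (n (f _)))]/(col (n (n (n _)))) n3 -[col (a _)]col_n kx.
by have /and3P[_ _] := col_vertex x; rewrite (eqP kx) eq_sym => /negPf->.
Qed.

Lemma fconnect_n x y : fconnect n x y = (y \in [:: x; n x; n (n x)]).
Proof.
apply/idP/idP=> [c|].
  apply: (connect_ind (P := fun y => y \in [:: x; n x; n (n x)]) _ c).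
    by move=> u v /eqP <-; rewrite !inE => /or3P[]/eqP->; rewrite ?n3 eqxx ?orbT.
  by rewrite inE eqxx.
by rewrite !inE => /or3P[]/eqP->; rewrite ?connect0 ?fconnect1 // (fconnect_iter n 2).
Qed.

Lemma uniq_vertex x : uniq [:: x; n x; n (n x)].
Proof.
rewrite /= !inE negb_or andbT; move: (col_vertex x).
have [<-|/= _] := eqVneq x (n x); first by rewrite eqxx.
have [<-|/= _] := eqVneq x (n (n x)); first by rewrite eqxx !andbF.
by have [<-|//] := eqVneq (n x) (n (n x)); rewrite eqxx andbF.
Qed.

Lemma card_vertex (C : {set D}) x :
  #|[set y in C | fconnect n x y]| = (x \in C) + (n x \in C) + (n (n x) \in C).
Proof.
rewrite (eq_card (B := [in filter [in C] [:: x; n x; n (n x)]])).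
  rewrite (card_uniqP _) ?filter_uniq ?uniq_vertex // size_filter /=.
  by rewrite addn0 addnA.
by move=> y; rewrite !inE mem_filter fconnect_n !inE.
Qed.

Lemma faceE x y : (forb a n x == forb a n y) = fconnect f x y.
Proof. exact: (comp_of_eqE (fconnect_sym f_inj)). Qed.

Lemma fconnect_col x y : fconnect f x y -> col y = col x.
Proof.
by move=> c; apply: (connect_ind (P := fun y => col y = col x) _ c) => // u v /eqP <-;
  rewrite col_face.
Qed.

(** * Regions and their boundaries *)

(* Such an [I] encodes the interior of the cycle [boundary I]. *)
Definition region (I : pred D) :=
  [/\ forall x, I (f x) = I x, forall x, col x = p -> I x
    & forall x, col x = q -> ~~ I x].

Definition boundary (I : pred D) : {set D} := [set x | I x != I (a x)].

Definition cycle_step (C : {set D}) : rel D :=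
  fun x y => ((x \in C) && (y == a x)) || (y == n x).

Definition connected_boundary I := forall x y, connect (cycle_step (boundary I)) x y.

Lemma connected_boundary_compl I :
  connected_boundary I -> connected_boundary (fun x => ~~ I x).
Proof.
rewrite /connected_boundary; suff -> : boundary (fun x => ~~ I x) = boundary I by [].
by apply/setP=> z; rewrite !inE; case: (I z); case: (I _).
Qed.

Section Region.
Variables (I : pred D).
Hypothesis I_face : forall x, I (f x) = I x.

Lemma I_a x : I (a x) = I (n x).
Proof. by rewrite -f_a I_face. Qed.

Lemma I_fconnect x y : fconnect f x y -> I y = I x.
Proof.
by move=> c; apply: (connect_ind (P := fun y => I y = I x) _ c) => // u v /eqP <-;
  rewrite I_face.
Qed.

Lemma boundary_a x : (a x \in boundary I) = (x \in boundary I).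
Proof. by rewrite !inE aK eq_sym. Qed.

Lemma same_side_sym (C : {set D}) : (forall x, (a x \in C) = (x \in C)) ->
  connect_sym (fun x y => ((x \notin C) && (y == a x)) || (y == f x)).
Proof.
move=> aC; set e := (fun x y => _).
have half u v : connect e u v -> connect e v u.
  move=> c; apply: (connect_ind (P := fun v => connect e v u) _ c); last exact: connect0.
  move=> w z /orP[/andP[wC]|] /eqP-> cw; apply: connect_trans cw.
    by rewrite connect1 // /e aC wC aK eqxx.
  have : fconnect f (f w) w by rewrite fconnect_sym ?fconnect1 //; exact: f_inj.
  by apply: connect_sub => x y /eqP <-; rewrite connect1 // /e eqxx orbT.
by move=> u v; apply/idP/idP; apply: half.
Qed.

(** Walking along the boundary keeps all inner faces at the current vertex reachable: two inner
    faces at a cubic vertex share an edge, which is off the boundary, and the inner face along a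
    boundary edge contains both its ends. *)
Lemma connected_boundary_same_side x y : connected_boundary I -> I x -> I y ->
  same_side a n (boundary I) x y.
Proof.
move=> cI Ix Iy; set C := boundary I.
have sym := same_side_sym boundary_a.
have nn u : I u -> I (n u) -> same_side a n C u (n u).
  move=> Iu Inu; apply: (@connect_trans _ _ (a u)).
    by apply: connect1; rewrite /C inE I_a Iu Inu !eqxx.
  by rewrite connect1 // f_a eqxx orbT.
pose R u := forall v, v \in [:: u; n u; n (n u)] -> I v -> same_side a n C x v.
have R1 u v : v \in [:: u; n u; n (n u)] -> I v -> same_side a n C x v -> R u.
  move=> vu Iv xv w wu Iw; apply: connect_trans xv _.
  have [E|nE] := eqVneq v w; first by rewrite E; exact: connect0.
  have [E|nE2] := eqVneq w (n v); first by move: Iw; rewrite E; apply: nn.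
  have E : v = n w.
    move: vu wu nE nE2; rewrite !inE => /or3P[]/eqP-> /or3P[]/eqP->;
      by rewrite ?n3 ?eqxx.
  by rewrite /same_side sym E; apply: nn; rewrite -?E.
suff : R y by apply=> //; rewrite inE eqxx.
apply: (connect_ind (P := R) _ (cI x y)); last first.
  by apply: (R1 _ x) => //; rewrite ?inE ?eqxx //; exact: connect0.
move=> u v /orP[/andP[uC /eqP->]|/eqP->] Ru; last first.
  by move=> w wu Iw; apply: Ru => //; move: wu; rewrite !inE n3 => /or3P[]->; rewrite ?orbT.
move: uC; rewrite /C inE; case Iu: (I u); case Iau: (I (a u)) => // _.
- apply: (R1 _ (f u)); rewrite ?inE ?eqxx ?orbT ?I_face //.
  apply: (connect_trans (Ru u _ Iu)); first by rewrite inE eqxx.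
  by rewrite connect1 // eqxx orbT.
- apply: (R1 _ (a u)); rewrite ?inE ?eqxx //.
  have Inu : I (n u) by rewrite -I_a.
  apply: connect_trans (Ru (n u) _ Inu) _; first by rewrite !inE eqxx orbT.
  by rewrite sym connect1 // f_a eqxx orbT.
Qed.

End Region.

Lemma vertex_col c x : [|| c == 1, c == p | c == q] ->
  exists2 v, v \in [:: x; n x; n (n x)] & col v = c.
Proof.
move=> cE; suff : c \in [seq col v | v <- [:: x; n x; n (n x)]].
  by case/mapP=> v vV ->; exists v.
by rewrite !inE; case/or3P: cE => /eqP->; case: (vertex_colP x); rewrite eqxx ?orbT.
Qed.

(** Around a vertex [I] takes both values, on the [p]-face and on the [q]-face, so among three faces
    it changes exactly twice. *)
Lemma boundary_two_per_vertex I x : region I ->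
  (x \in boundary I) + (n x \in boundary I) + (n (n x) \in boundary I) = 2.
Proof.
move=> [If Ip Iq]; rewrite !inE !(I_a If) n3.
have [u uV /Ip Iu] : exists2 v, v \in [:: x; n x; n (n x)] & col v = p.
  by apply: vertex_col; rewrite eqxx orbT.
have [v vV /Iq Iv] : exists2 v, v \in [:: x; n x; n (n x)] & col v = q.
  by apply: vertex_col; rewrite eqxx !orbT.
move: uV vV Iu Iv; rewrite !inE => /or3P[]/eqP-> /or3P[]/eqP-> Iu Iv;
 move: Iu Iv; do 3?case: (I _) => //.
Qed.

Lemma ham_cycle_boundary I : region I -> connected_boundary I ->
  ham_cycle a n (boundary I).
Proof.
move=> rI cI; split=> //; first exact: boundary_a.
by move=> x; rewrite card_vertex boundary_two_per_vertex.
Qed.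

Definition separating_ham_cycle (od : D) (C : {set D}) :=
  ham_cycle a n C /\
  forall x, (col x = p -> ~~ same_side a n C od x) /\ (col x = q -> same_side a n C od x).

Lemma separating_ham_cycleP od : col od = q ->
  (exists C, separating_ham_cycle od C) <-> exists2 I, region I & connected_boundary I.
Proof.
move=> cod; split=> [[C [[aC C2 cC] sC]]|[I rI cI]].
  (* The inside is whatever cannot be reached from the outer face without crossing [C]. *)
  pose I x := ~~ same_side a n C od x.
  have sym := same_side_sym aC.
  have If x : I (f x) = I x.
    congr (~~ _); apply: (same_connect_r sym); rewrite sym.
    by apply: connect1; rewrite eqxx orbT.
  have rI : region I.
    by split=> // x; case: (sC x) => // _ h /h; rewrite /I negbK.
  exists I => // x y.
  have sub z : z \in boundary I -> z \in C.
    rewrite inE; apply: contraNT => zC; apply/eqP; congr (~~ _).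
    apply: (same_connect_r sym); apply: connect1; by rewrite zC eqxx.
  (* Both sets have two darts at each vertex, so the inclusion is an equality; this replaces the
     Jordan curve theorem. *)
  suff -> : boundary I = C by apply: cC.
  apply/setP=> z; apply/idP/idP; first exact: sub.
  have := C2 z; rewrite card_vertex -(boundary_two_per_vertex z rI).
  have {}sub w : (w \in boundary I) ==> (w \in C) by apply/implyP/sub.
  move: (sub z) (sub (n z)) (sub (n (n z))).
  by do 3!case: (_ \in boundary I); do 3!case: (_ \in C).
exists (boundary I); split; first exact: ham_cycle_boundary.
case: rI => If Ip Iq x; split=> cx; last first.
  have -> : boundary I = boundary (fun x => ~~ I x).
    by apply/setP=> z; rewrite !inE; case: (I z); case: (I _).
  apply: connected_boundary_same_side; rewrite ?Iq //.
    by move=> z; rewrite If.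
  exact: connected_boundary_compl.
apply/negP=> c; have: ~~ I x; last by rewrite Ip.
apply: (connect_ind (P := fun x => ~~ I x) _ c); last exact: Iq.
by move=> u v /orP[/andP[+ /eqP->]|/eqP->]; rewrite ?If // inE negbK => /eqP <-.
Qed.

(** * A-trails *)

(** Of each edge between a [p]- and a [q]-face this selects one dart, that is, a direction of
    travel. *)
Definition crossing x := (col x == p) && (col (a x) == q).

Definition touches k u :=
  (k \in [:: u; n u; n (n u)]) || (a k \in [:: u; n u; n (n u)]).

(** On kept darts [turn] is the rotation [ncon] by [nconE]; [unturn] is its inverse, so an A-trail
    has these two ways to continue. *)
Definition turn x := n (a (n x)).
Definition unturn x := n (n (a (n (n x)))).

Lemma turnK : cancel turn unturn.
Proof. by move=> x; rewrite /turn /unturn n3 aK n3. Qed.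

Lemma unturnK : cancel unturn turn.
Proof. by move=> x; rewrite /turn /unturn n3 aK n3. Qed.

Lemma kept1E x : kept a col 1 x = crossing x || crossing (a x).
Proof.
rewrite kept_col // /crossing aK -!col_n.
by case: (vertex_colP x); rewrite ?eqxx ?colF.
Qed.

Lemma crossing_kept x : crossing x -> kept a col 1 x.
Proof. by rewrite kept1E => ->. Qed.

Lemma crossing_kept_a x : crossing x -> kept a col 1 (a x).
Proof. by rewrite kept1E aK => ->; rewrite orbT. Qed.

Lemma crossing_aF x : crossing x -> crossing (a x) = false.
Proof. by case/andP=> /eqP px _; rewrite /crossing aK px colF andbF. Qed.

Lemma crossing_cols x : crossing x ->
  [/\ col x = p, col (a x) = q, col (n (a x)) = p & col (n (n (a x))) = 1].
Proof.
case/andP=> /eqP xp /eqP aq.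
have fx : col (n (a x)) = p by rewrite col_n aK.
by split=> //; case: (vertex_colP (a x)) aq fx; colour_cases.
Qed.

(** Around a contracted 1-face the [p]- and [q]-faces alternate, so both neighbours of the reverse
    of a crossing dart are crossing. *)
Lemma crossing_turn x : crossing x -> crossing (turn (a x)).
Proof.
move=> /crossing_cols[xp aq fp h1]; rewrite /crossing /turn.
have c1 : col (a (n (a x))) = 1 by rewrite -col_n.
have c2 : col (n (a (n (a x)))) = p by rewrite col_n aK.
rewrite c2 eqxx -col_n /=; apply/eqP.
by case: (vertex_colP (a (n (a x)))) c1 c2; colour_cases.
Qed.

Lemma crossing_unturn x : crossing x -> crossing (unturn (a x)).
Proof.
move=> /crossing_cols[xp aq fp h1]; rewrite /crossing /unturn.
set z := n (n (a x)) in h1 *.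
have c1 : col (a z) = q by rewrite -col_n /z n3.
have c2 : col (n (a z)) = 1 by rewrite col_n aK.
rewrite -[col (a _)]col_n n3 c1 eqxx andbT; apply/eqP.
by case: (vertex_colP (a z)) c1 c2; colour_cases.
Qed.

(** The edge opposite the 1-face at a vertex is its only edge between a [p]- and a [q]-face. These
    edges form a perfect matching, so walks on vertices translate into walks on crossing darts. *)
Lemma touches_ex u : exists2 k, crossing k & touches k u.
Proof.
have [v vV v1] := vertex_col u (isT : [|| 1 == 1, 1 == p | 1 == q]).
have nvV : n v \in [:: u; n u; n (n u)].
  by move: vV; rewrite !inE => /or3P[]/eqP->; rewrite ?n3 eqxx ?orbT.
have : kept a col 1 (n v) by rewrite kept_col // n3 v1.
rewrite kept1E => /orP[c|c]; first by exists (n v); rewrite // /touches nvV.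
by exists (a (n v)); rewrite // /touches aK nvV orbT.
Qed.

Lemma touches_uniq k k' u : crossing k -> crossing k' -> touches k u -> touches k' u -> k = k'.
Proof.
have kept_uniq w w' : w \in [:: u; n u; n (n u)] -> w' \in [:: u; n u; n (n u)] ->
    kept a col 1 w -> kept a col 1 w' -> w = w'.
  rewrite !kept_col // !inE => /or3P[]/eqP-> /or3P[]/eqP->; do ?rewrite n3 //;
  case: (vertex_colP u) => /eqP ? /eqP ?; colour_cases.
move=> c c' /orP[t|t] /orP[t'|t'].
- by apply: kept_uniq => //; apply: crossing_kept.
- have E := kept_uniq _ _ t t' (crossing_kept c) (crossing_kept_a c').
  by have := crossing_aF c'; rewrite -E c.
- have E := kept_uniq _ _ t t' (crossing_kept_a c) (crossing_kept c').
  by have := crossing_aF c; rewrite E c'.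
- by apply: a_inj; apply: kept_uniq; rewrite ?crossing_kept_a.
Qed.

Lemma A_trail_of_region (x0 : D) I : region I -> connected_boundary I ->
  exists s, A_trail a n col 1 s.
Proof.
move=> [If Ip Iq] cI.
(* The 1-face at the head of [x] decides to which side the trail turns, and [psi x] starts on the
   same 1-face. All turns at a 1-face thus agree, which makes [psi] injective; it is the identity
   elsewhere so as to permute all darts. *)
pose psi x := if crossing x then
  (if I (n (n (a x))) then unturn (a x) else turn (a x)) else x.
have psiK x : crossing x -> crossing (psi x).
  by move=> cx; rewrite /psi cx; case: ifP => _; rewrite ?crossing_turn ?crossing_unturn.
have psiI x : crossing x -> I (n (n (psi x))) = I (n (n (a x))).
  move=> cx; rewrite /psi cx; case: ifP => E.
    by rewrite /unturn n3 -[n (a _)]/(f _) If.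
  by rewrite /turn n3 (I_a If).
have psi_inj : injective psi.
  move=> x y; case cx: (crossing x); case cy: (crossing y).
  - move=> E; have := psiI x cx; rewrite E psiI // => EI.
    move: E; rewrite /psi cx cy -EI.
    by case: ifP => _; [move/(can_inj unturnK)|move/(can_inj turnK)] => /a_inj.
  - by move=> E; have := psiK x cx; rewrite E /psi cy cy.
  - by move=> E; have := psiK y cy; rewrite -E /psi cx cx.
  - by rewrite /psi cx cy.
have [k0 ck0 _] := touches_ex x0.
have orbK x : x \in orbit psi k0 -> crossing x.
  rewrite -fconnect_orbit => c; apply: (connect_ind (P := crossing) _ c) => //.
  by move=> u v /eqP <-; apply: psiK.
pose R u := exists k, [/\ crossing k, touches k u & fconnect psi k0 k].
have allR u : R u.
  apply: (connect_ind (P := R) _ (cI k0 u)); last first.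
    by exists k0; rewrite /touches inE eqxx connect0.
  move=> {}u v /orP[/andP[uC /eqP->{v}]|/eqP->{v}] [k [ck tk ok]]; last first.
    exists k; split=> //; move: tk; rewrite /touches !inE n3.
    by case/orP=> /or3P[]->; rewrite ?orbT.
  (* On the boundary a [p]-1 edge has its 1-face outside and a 1-[q] edge has it inside; each joins
     the head of a crossing dart to the tail of its [psi]-successor. *)
  have side v : v \in boundary I -> col v = p -> col (a v) = 1 ->
    [/\ crossing (a (n (n v))), touches (a (n (n v))) v, crossing (n (a v)),
      touches (n (a v)) (a v) & psi (a (n (n v))) = n (a v)].
    move=> vC vp v1.
    have Inv : I (n v) = false.
      by move: vC; rewrite inE (I_a If) Ip //; case: (I (n v)).
    have c : crossing (a (n (n v))).
      rewrite /crossing aK -col_n n3 vp eqxx /=; apply/eqP; move: v1; rewrite -col_n.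
      by case: (vertex_colP v) vp; colour_cases.
    have E : psi (a (n (n v))) = n (a v) by rewrite /psi c aK n3 Inv /turn n3.
    split=> //.
    + by rewrite /touches aK !inE eqxx !orbT.
    + by rewrite -E psiK.
    + by rewrite /touches !inE eqxx !orbT.
  have side' v : v \in boundary I -> col v = 1 -> col (a v) = q ->
    [/\ crossing (a (n v)), touches (a (n v)) v, crossing (n (n (a v))),
      touches (n (n (a v))) (a v) & psi (a (n v)) = n (n (a v))].
    move=> vC v1 vq.
    have Iv : I v by move: vC; rewrite inE (negPf (Iq _ vq)); case: (I v).
    have c : crossing (a (n v)).
      rewrite /crossing aK -col_n; move: vq; rewrite -col_n.
      by case: (vertex_colP v) v1; rewrite ?eqxx; colour_cases.
    have E : psi (a (n v)) = n (n (a v)) by rewrite /psi c aK n3 Iv /unturn n3.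
    split=> //.
    + by rewrite /touches aK !inE eqxx !orbT.
    + by rewrite -E psiK.
    + by rewrite /touches !inE eqxx !orbT.
  have finish k1 k2 : crossing k1 -> touches k1 u -> crossing k2 -> touches k2 (a u) ->
      psi k1 = k2 \/ psi k2 = k1 -> R (a u).
    move=> c1 t1 c2 t2; have -> := touches_uniq c1 ck t1 tk => E.
    exists k2; split=> //; case: E => E; first by rewrite -E -same_fconnect1_r.
    by rewrite (same_fconnect1_r psi_inj) E.
  have uC' : a u \in boundary I by rewrite boundary_a.
  have : [|| kept a col 1 u, (col u == p) && (col (a u) == 1),
     (col u == 1) && (col (a u) == p), (col u == 1) && (col (a u) == q)
   | (col u == q) && (col (a u) == 1)].
    by rewrite kept_col // -col_n; case: (vertex_colP u); rewrite ?eqxx ?orbT.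
  case/orP; last case/or4P=> /andP[/eqP c1 /eqP c2].
  - rewrite kept1E => /orP[cu|cu]; exists k; split=> //.
      by have <- : u = k; rewrite /touches ?inE ?eqxx ?orbT //;
        apply: (touches_uniq cu ck _ tk); rewrite /touches inE eqxx.
    by have <- : a u = k; rewrite /touches ?inE ?eqxx ?orbT //;
      apply: (touches_uniq cu ck _ tk); rewrite /touches aK !inE eqxx orbT.
  - have [k1 t1 k2 t2 E] := side u uC c1 c2.
    by apply: (finish _ _ k1 t1 k2 t2); left.
  - have := side (a u) uC' c2; rewrite aK => /(_ c1)[k1 t1 k2 t2 E].
    by apply: (finish _ _ k2 t2 k1 t1); right.
  - have [k1 t1 k2 t2 E] := side' u uC c1 c2.
    by apply: (finish _ _ k1 t1 k2 t2); left.
  - have := side' (a u) uC' c2; rewrite aK => /(_ c1)[k1 t1 k2 t2 E].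
    by apply: (finish _ _ k2 t2 k1 t1); right.
have orbE x : (x \in orbit psi k0) = crossing x.
  apply/idP/idP=> [/orbK //|cx]; rewrite -fconnect_orbit.
  have [k [ck tk ok]] := allR x.
  by rewrite (touches_uniq cx ck _ tk) // /touches inE eqxx.
exists (orbit psi k0); split.
- by apply/allP=> x; rewrite orbE => /crossing_kept.
- move=> x; rewrite kept1E !count_uniq_mem ?orbit_uniq // !orbE.
  case cx: (crossing x) => /= => [_|->//].
  by rewrite (crossing_aF cx).
- apply: (sub_in_cycle (P := crossing)) (cycle_orbit psi_inj k0); last first.
    by apply/allP=> x; rewrite orbE.
  move=> x y cx cy /eqP; rewrite /psi (cx : crossing x) => E.
  rewrite !nconE ?crossing_kept_a ?crossing_kept //.
  by move: E; case: ifP => _ <-; rewrite -!/(turn _) ?unturnK eqxx ?orbT.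
Qed.

Lemma cycle_step_vertex C u w : w \in [:: u; n u; n (n u)] ->
  connect (cycle_step C) u w /\ connect (cycle_step C) w u.
Proof.
have st x : connect (cycle_step C) x (n x) by rewrite connect1 // /cycle_step eqxx orbT.
have st2 x : connect (cycle_step C) x (n (n x)) by apply: connect_trans (st _) (st _).
rewrite !inE => /or3P[]/eqP->; rewrite ?connect0 //; split=> //.
  by rewrite -{2}(n3 u).
by rewrite -{2}(n3 u).
Qed.

Lemma region_of_A_trail s : A_trail a n col 1 s -> all crossing s ->
  exists2 I, region I & connected_boundary I.
Proof.
move=> [_ cnt cyc] /allP sK.
have sE x : (x \in s) = crossing x.
  apply/idP/idP=> [/sK //|cx]; rewrite -has_pred1 has_count.
  have := cnt x (crossing_kept cx).
  suff -> : count_mem (a x) s = 0 by rewrite addn0 => ->.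
  by apply/count_memPn/negP=> /sK; rewrite crossing_aF.
have us : uniq s.
  apply/count_mem_uniq => x; rewrite sE; case cx: (crossing x); last first.
    by apply/count_memPn; rewrite sE cx.
  have := cnt x (crossing_kept cx); suff -> : count_mem (a x) s = 0 by rewrite addn0.
  by apply/count_memPn; rewrite sE crossing_aF.
pose nx := next s.
have nxK x : crossing x -> crossing (nx x) by rewrite -!sE mem_next.
(* True if the trail continues with [unturn (a x)]; the 1-faces where it does so are put inside. *)
pose type x := a x == turn (nx x).
have nxE x : crossing x -> ~~ type x -> nx x = turn (a x).
  move=> cx; have := next_cycle cyc (_ : x \in s); rewrite sE => /(_ cx).
  rewrite !nconE ?crossing_kept_a ?crossing_kept ?nxK //.
  by rewrite /type -!/(turn _) => /orP[/eqP|->].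
have nx_inj : injective nx by apply: can_inj (prev_next us).
(* The trail arrives at every other vertex of a 1-face; at the remaining ones the type is read off
   the next vertex of the face. *)
pose I z := (col z == p) || (col z == 1) &&
  (if col (n z) == q then type (a (n z)) else type (a (n (f z)))).
have headK z : col z = 1 -> col (n z) = q -> crossing (a (n z)).
  move=> z1 zq; rewrite /crossing aK zq -col_n eqxx andbT; apply/eqP.
  by case: (vertex_colP z) z1 zq; colour_cases.
have fq z : col z = 1 -> col (n z) = p -> col (n (f z)) = q.
  move=> z1; rewrite col_n => zp.
  have : col (n (a z)) = 1 by rewrite col_n aK.
  by rewrite /fstep; case: (vertex_colP (a z)) zp; colour_cases.
have fp z : col z = 1 -> col (n z) = q -> col (n (f z)) = p.
  move=> z1; rewrite col_n => zp.
  have : col (n (a z)) = 1 by rewrite col_n aK.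
  by rewrite /fstep; case: (vertex_colP (a z)) zp; colour_cases.
have nz z : col z = 1 -> col (n z) = p \/ col (n z) = q.
  by case: (vertex_colP z); try (by left); try (by right); colour_cases.
(* Around the 1-face one outgoing dart [y] lies between the arrivals [x] and [x']. It follows
   exactly one dart of the trail, so both arrivals turn to the same side. *)
have type_face z : col z = 1 -> col (n z) = q -> type (a (n (f (f z)))) = type (a (n z)).
  move=> z1 zq; set x := a (n z); set x' := a (n (f (f z))).
  have cx : crossing x by apply: headK.
  have cx' : crossing x' by apply: headK; rewrite ?col_face // fq ?col_face // fp.
  set y := unturn (a x).
  have ay : turn y = a x by rewrite /y unturnK.
  have ax' : a x' = unturn y.
    by rewrite /x' /y /x !aK /unturn n3 n3 /fstep.
  have cy : crossing y by apply: crossing_unturn.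
  apply/idP/idP=> t.
    have Ey : nx (prev s y) = y by apply: next_prev.
    have cp : crossing (prev s y) by rewrite -sE mem_prev sE.
    case: (boolP (type (prev s y))) => [tp|/(nxE _ cp)].
      by have <- : prev s y = x by apply: a_inj; rewrite -ay -[in RHS]Ey; apply/eqP.
    rewrite Ey => E; have Ep : prev s y = x'.
      by apply: a_inj; rewrite ax' [in RHS]E turnK.
    by move: (t); rewrite -[in X in X -> _]Ep /type Ey ay => /eqP/a_inj <-; rewrite Ep.
  apply/negPn/negP=> nt; have E := nxE _ cx' nt.
  have Exx : x' = x.
    apply: nx_inj; rewrite E ax' unturnK /y (eqP t) turnK //.
  by rewrite Exx t in nt.
have If z : I (f z) = I z.
  rewrite /I col_face; case: (eqVneq (col z) 1) => [z1|//] /=.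
  congr (_ || _); case: (nz z z1) => zE.
    by rewrite (fq _ z1 zE) zE eqxx colF.
  by rewrite (fp _ z1 zE) zE eqxx colF type_face.
have Ip x : col x = p -> I x by rewrite /I => ->; rewrite eqxx.
have Iq x : col x = q -> ~~ I x by rewrite /I => ->; rewrite !colF.
exists I; first by split.
have Ihead x : crossing x -> I (n (n (a x))) = type x.
  move=> cx; have [xp aq fxp h1] := crossing_cols cx.
  by rewrite /I h1 colF n3 aq !eqxx aK.
have stA (C : {set D}) x : x \in C -> connect (cycle_step C) x (a x).
  by move=> xC; rewrite connect1 // /cycle_step xC eqxx.
have stn (C : {set D}) x : connect (cycle_step C) x (n x) by rewrite connect1 // /cycle_step eqxx orbT.
set C := boundary I.
have KC x : crossing x -> x \in C.
  by case/andP=> /eqP xp /eqP xq; rewrite inE Ip // (negPf (Iq _ xq)).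
(* After the crossing edge the boundary follows a 1-[q] edge if the 1-face is inside and a [p]-1
   edge if it is outside, exactly as the trail turns. *)
have trail_step x : x \in s -> connect (cycle_step C) x (nx x).
  rewrite sE => cx; have [xp aq fxp h1] := crossing_cols cx.
  apply: connect_trans (stA _ _ (KC _ cx)) _; apply: connect_trans (stn _ _) _.
  case: (boolP (type x)) => t.
    apply: connect_trans (stn _ _) _.
    have -> : nx x = n (n (a (n (n (a x))))) by rewrite -[RHS]/(unturn _) (eqP t) turnK.
    apply: connect_trans (stA _ _ _) _; last exact: connect_trans (stn _ _) (stn _ _).
    by rewrite inE Ihead // t (negPf (Iq _ _)) // -col_n n3.
  rewrite (nxE _ cx t); apply: connect_trans (stA _ _ _) (stn _ _).
  by rewrite inE Ip // (I_a If) Ihead // (negPf t).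
have trailC x y : crossing x -> crossing y -> connect (cycle_step C) x y.
  rewrite -!sE => xs ys; have := connect_cycle (cycle_next us) xs ys.
  apply: connect_sub => u v /eqP <-; case: (boolP (u \in s)) => [/trail_step //|us'].
  by rewrite next_nth (negPf us') connect0.
have near u k : crossing k -> touches k u ->
    connect (cycle_step C) u k /\ connect (cycle_step C) k u.
  move=> ck /orP[/(cycle_step_vertex C) //|/(cycle_step_vertex C)[c1 c2]].
  have kC := KC _ ck; have akC : a k \in C by rewrite boundary_a.
  split; last exact: connect_trans (stA _ _ kC) c2.
  by apply: connect_trans c1 _; have := stA _ _ akC; rewrite aK.
move=> x y; have [k ck tk] := touches_ex x; have [k' ck' tk'] := touches_ex y.
apply: connect_trans (proj1 (near _ _ ck tk)) _.
exact: connect_trans (trailC _ _ ck ck') (proj2 (near _ _ ck' tk')).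
Qed.

(** Turning preserves the direction of travel relative to the colours. The second case is a crossing
    trail for the exchanged colours. *)
Lemma A_trail_monochromatic s : A_trail a n col 1 s ->
  all crossing s \/ all (fun x => crossing (a x)) s.
Proof.
move=> [/allP sk _ cyc].
case: s sk cyc => [|x0 s] sk cyc; first by left.
have keep u v : u \in x0 :: s -> v \in x0 :: s -> crossing u -> crossing v.
  have cyc' : cycle (fun x y => [&& kept a col 1 x, kept a col 1 y &
      (y == ncon a n col 1 (a x)) || (a x == ncon a n col 1 y)]) (x0 :: s).
    apply: (sub_in_cycle (P := kept a col 1)) cyc; last exact/allP.
    by move=> x y kx ky ->; rewrite (kx : kept _ _ _ _) (ky : kept _ _ _ _).
  move=> us vs; apply: (connect_ind (P := crossing)) (connect_cycle cyc' us vs) => x y.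
  case/and3P=> kx ky exy cx.
  move: exy; rewrite !nconE ?crossing_kept_a // => /orP[/eqP->|/eqP E].
    exact: crossing_turn.
  by have := crossing_unturn cx; rewrite E turnK.
have := sk x0 (mem_head _ _); rewrite kept1E => /orP[c0|c0].
  by left; apply/allP=> y ys; apply: keep c0; rewrite ?mem_head.
right; apply/allP=> y ys; have := sk y ys; rewrite kept1E => /orP[cy|//].
have := keep _ _ ys (mem_head x0 s) cy => c0'.
by rewrite crossing_aF in c0.
Qed.

(** * Two faces share at most one edge *)

Lemma a_neq x : a x != x.
Proof. by apply/eqP=> E; have := col_edge x; rewrite E eqxx. Qed.

Lemma porbit_vorb x : porbit (perm n_inj) x = vorb n x.
Proof.
apply/setP=> y; rewrite inE porbit_fconnect; apply: eq_fconnect => z.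
exact: permE.
Qed.

Lemma mul_perm_face x : (perm a_inj * perm n_inj)%g x = f x.
Proof. by rewrite permM !permE. Qed.

Lemma porbit_forb x : porbit (perm a_inj * perm n_inj) x = forb a n x.
Proof.
apply/setP=> y; rewrite inE porbit_fconnect; apply: eq_fconnect => z.
exact: mul_perm_face.
Qed.

Lemma card_edges : #|porbits (perm a_inj)|.*2 = #|D|.
Proof.
have paK x : perm a_inj (perm a_inj x) = x by rewrite !permE.
have := card_porbits_invol paK; rewrite (_ : [set x | _] = setT) ?cardsT; last first.
  by apply/setP=> x; rewrite !inE permE a_neq.
by move: #|porbits _| #|D|; lia.
Qed.

(* Deleting both common edges keeps the number of faces: the first deletion
   merges the two faces and the second one splits the result.  By Euler's
   inequality the rest is disconnected, so one end of each edge forms a cut. *)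
Lemma faces_share_one_edge x y :
  is_plane a n -> (forall u v, connect (fun s t => (t == a s) || (t == n s)) u v) ->
  three_connected a n -> (forall u, ~~ fconnect n u (a u)) ->
  col x = 1 -> col (a x) = p -> col y = 1 -> col (a y) = p ->
  fconnect f x y -> fconnect f (a x) (a y) -> x = y.
Proof.
move=> plane conn [_ conn3] loopless x1 xp y1 yp fxy faxy.
apply/eqP/negPn/negP=> nxy.
have nxay : x != a y by apply/eqP=> E; move/eqP: x1; rewrite E yp colF.
have nyax : y != a x by apply/eqP=> E; move/eqP: y1; rewrite E xp colF.
pose pn := perm n_inj; pose pa := perm a_inj; pose g := (pa * pn)%g.
(* Making both darts of an edge fixed points deletes the edge and adds one orbit. *)
pose pa1 := (tperm y (a y) * pa)%g; pose pa2 := (tperm x (a x) * pa1)%g.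
have zpa1 : #|porbits pa1| = #|porbits pa| + 1.
  have /= := porbits_mul_tperm pa y (a y); rewrite -/pa1 eq_sym a_neq.
  by have -> : y \in porbit pa (a y); [apply/porbitP; exists 1; rewrite permE aK|rewrite addn0].
have zpa2 : #|porbits pa2| = #|porbits pa| + 2.
  have /= := porbits_mul_tperm pa1 x (a x); rewrite -/pa2 [x == _]eq_sym a_neq zpa1.
  have -> : x \in porbit pa1 (a x); last by rewrite addn0 => ->; rewrite -addnA.
  apply/porbitP; exists 1; rewrite permM permE tpermD ?aK //.
  by rewrite (inj_eq a_inj) eq_sym.
pose g1 := (tperm y (a y) * g)%g.
have gy : y \notin porbit g (a y).
  rewrite porbit_forb inE; apply/negP=> /fconnect_col; rewrite y1 yp => /eqP.
  by rewrite colF.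
have zg1 : #|porbits g1| + 1 = #|porbits g|.
  have /= := porbits_mul_tperm g y (a y); rewrite -/g1 gy eq_sym a_neq /=.
  by move: #|porbits g1| #|porbits g|; lia.
have m1 := porbit_mul_tperm_merge gy; rewrite -/g1 in m1.
have E1 : porbit g1 (a y) = porbit g1 y by apply/eqP; rewrite eq_porbit_mem.
have sub1 := porbit_mul_tperm_sub m1; rewrite -/g1 in sub1.
have sub2 : porbit g (a y) \subset porbit g1 y.
  have := @porbit_mul_tperm_sub _ g (a y) y; rewrite tpermC -/g1 E1 => -> //.
  exact: porbit_id.
have gx : x \in porbit g1 (a x).
  have xg : x \in porbit g1 y.
    by apply: (subsetP sub1); rewrite porbit_forb inE fconnect_sym //; apply: f_inj.
  have axg : a x \in porbit g1 y.
    by apply: (subsetP sub2); rewrite porbit_forb inE fconnect_sym //; apply: f_inj.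
  rewrite -eq_porbit_mem in xg; rewrite -eq_porbit_mem in axg.
  by rewrite -eq_porbit_mem (eqP xg) (eqP axg).
have zg2 : #|porbits (pa2 * pn)| = #|porbits g|.
  have /= := porbits_mul_tperm g1 x (a x); rewrite gx [x == _]eq_sym a_neq zg1 addn0.
  by rewrite /g1 /g /pa2 /pa1 !mulgA.
(* [V + (E + 2) + F <= 2E + 2c] and [V + F = E + 2] give [c >= 2]. *)
have : 1 < ncomp (perm2_rel pn pa2).
  have := euler_inequality pn pa2; rewrite zg2 zpa2.
  have := card_edges; rewrite -/pa => E.
  move: plane; rewrite /is_plane /nvertices /nfaces /nedges.
  have <- : porbits pn = [set vorb n x | x : D].
    by apply: eq_imset => z; exact: porbit_vorb.
  have <- : porbits g = [set forb a n x | x : D].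
    by apply: eq_imset => z; exact: porbit_forb.
  move: E; rewrite -/pa -/g; move: #|porbits pn| #|porbits pa| #|porbits g| (ncomp _) => V E F c.
  by move: #|D| => d <-; rewrite -muln2 mulnK //; lia.
case/card_gt1P=> _ [_ [/imsetP[u _ ->] /imsetP[v _ ->]]].
rewrite comp_of_eqE => [nuv|]; last exact: perm2_csym.
pose A := comp_of (perm2_rel pn pa2) u.
have uA : u \in A by apply: comp_of_refl.
have vA : v \notin A by rewrite inE.
pose M := [:: x; a x; y; a y].
have memM z : z \in M -> [\/ z = x, z = a x, z = y | z = a y].
  by rewrite !inE => /or4P[]/eqP; [constructor 1|constructor 2|constructor 3|constructor 4].
have stepA z w : perm2_rel pn pa2 z w -> (w \in A) = (z \in A).
  by move=> zw; rewrite !inE -(same_connect1r (perm2_csym pn pa2) zw).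
have nA z : (n z \in A) = (z \in A) by apply: stepA; rewrite /perm2_rel permE eqxx.
have aA z : z \notin M -> (a z \in A) = (z \in A).
  move=> zM; apply: stepA; move: zM; rewrite !inE !negb_or => /and4P[z1 z2 z3 z4].
  by rewrite /perm2_rel !permM !tpermD ?permE ?eqxx ?orbT // eq_sym.
have vorbA z w : w \in vorb n z -> (w \in A) = (z \in A).
  move=> wz; have : [|| w == z, w == n z | w == n (n z)].
    by move: wz; rewrite inE fconnect_n !inE.
  by case/or3P=> /eqP->; rewrite ?nA.
(* A vertex has only one 1-[p] edge, the one opposite its [q]-face. So the edge of [n z] survives
   and leads to another vertex of the same component. *)
have Mcol z : z \in M -> col (n (n z)) = q.
  have aux w : col w = 1 -> col (n w) = p -> col (n (n w)) = q.
    by case: (vertex_colP w); colour_cases.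
  have aux' w : col w = p -> col (n w) = 1 -> col (n (n w)) = q.
    by case: (vertex_colP w); colour_cases.
  by rewrite !inE => /or4P[]/eqP->; [apply: aux|apply: aux'|apply: aux|apply: aux'];
    rewrite ?col_n ?aK.
have Mn z : z \in M -> n z \notin M.
  move=> /Mcol zq; apply/negP=> /Mcol; rewrite n3 => zq'.
  by move: (col_vertex z); rewrite zq zq' eqxx !andbF.
have far z : z \in M -> (a (n z) \in A) = (z \in A) /\ a (n z) \notin vorb n z.
  move=> zM; rewrite aA ?Mn // nA; split=> //; rewrite inE.
  by apply: contra (loopless (n z)); rewrite -same_fconnect1 //; apply: n_inj.
pose cut z := (z \in A) && (a z \notin A).
have cutM z : cut z -> z \in M.
  by case/andP=> zA; apply: contraNT => /aA ->.
pose onx z := (z == x) || (z == a x).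
have cut_eq z z' : cut z -> cut z' -> onx z = onx z' -> z = z'.
  move=> zc z'c; have [zA /negPf azA] := andP zc; have [z'A /negPf az'A] := andP z'c.
  have onxy : onx y = false by rewrite /onx eq_sym (negPf nxy) (negPf nyax).
  have onxay : onx (a y) = false.
    by rewrite /onx eq_sym (negPf nxay) (inj_eq a_inj) eq_sym (negPf nxy).
  have onxx : onx x by rewrite /onx eqxx.
  have onxax : onx (a x) by rewrite /onx eqxx orbT.
  case: (memM _ (cutM _ zc)) => E; case: (memM _ (cutM _ z'c)) => E';
    rewrite E E' ?onxy ?onxay ?onxx ?onxax // => _;
    by rewrite E E' ?aK in zA azA z'A az'A; rewrite ?zA ?z'A in azA az'A.
have contra_cut S1 S2 P Q : (forall z, cut z ->
      (z \in vorb n S1 :|: vorb n S2) || (a z \in vorb n S1 :|: vorb n S2)) ->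
    P \in A -> Q \notin A -> P \notin vorb n S1 :|: vorb n S2 ->
    Q \notin vorb n S1 :|: vorb n S2 -> False.
  move=> cutS PA QA PS QS; case/negP: QA.
  apply: (connect_ind (P := fun z => z \in A) _ (conn3 S1 S2 P Q PS QS)) => // z w.
  case/and3P=> zS wS /orP[]/eqP E zA; last by rewrite E nA.
  apply/negPn/negP=> wA; have /cutS : cut z by rewrite /cut zA -E.
  by rewrite -E (negPf zS) (negPf wS).
have [w wcut] : exists w, cut w.
  case: (pickP cut) => [w cw|nocut]; first by exists w.
  case/negP: vA; apply: (connect_ind (P := fun z => z \in A) _ (conn u v)) => // z w.
  case/orP=> /eqP-> zA; last by rewrite nA.
  by have := nocut z; rewrite /cut zA => /negbFE.
have [wA awA] := andP wcut; have wM := cutM w wcut.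
have [farA farV] := far w wM; rewrite wA in farA.
case: (pickP (fun w' => cut w' && (w' != w))) => [w' /andP[w'cut w'w]|nocut].
  have [w'A aw'A] := andP w'cut; have w'M := cutM w' w'cut.
  have aw'M : a w' \in M.
    by move: w'M; rewrite !inE => /or4P[]/eqP->; rewrite ?aK eqxx ?orbT.
  have [far'A far'V] := far (a w') aw'M; rewrite (negPf aw'A) in far'A.
  (* Each cut edge loses an end, [w] the one in [A] and [w'] the one outside; chosen on opposite
     sides, they leave a vertex on each side to be separated. *)
  apply: (contra_cut w (a w') (a (n w)) (a (n (a w')))) => //.
  - move=> z zcut; have [zA azA] := andP zcut; have zM := cutM z zcut.
    have [->|->] : z = w \/ z = w'.
      case: (eqVneq (onx z) (onx w)) => [/(cut_eq _ _ zcut wcut)|nzw]; first by left.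
      case: (eqVneq (onx z) (onx w')) => [/(cut_eq _ _ zcut w'cut)|nzw']; first by right.
      have E : onx w' = onx w by move: nzw nzw'; do 3!case: (onx _).
      by rewrite (cut_eq _ _ w'cut wcut E) eqxx in w'w.
    + by rewrite !inE connect0.
    + by rewrite !inE connect0 !orbT.
  - by rewrite far'A.
  - rewrite inE negb_or farV; apply/negP=> /vorbA; by rewrite farA (negPf aw'A).
  - rewrite inE negb_or far'V andbT; apply/negP=> /vorbA; by rewrite far'A wA.
(* With a single cut edge, its end in [A] separates alone and its other end is the witness
   outside. *)
apply: (contra_cut w w (a (n w)) (a w)) => //.
- move=> z zcut; have := nocut z; rewrite zcut => /negbFE/eqP->.
  by rewrite !inE connect0.
- by rewrite inE negb_or farV.
- by rewrite setUid; apply/negP=> /vorbA; rewrite wA (negPf awA).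
Qed.

(** * Counting faces and edges of a region *)

(** An edge is counted by its dart on the [i]-face, and only that face has to lie in [J]. *)
Definition edges (J : pred D) i j :=
  #|[set x | [&& J x, col x == i & col (a x) == j]]|.

Definition nfaces_in (J : pred D) := #|[set forb a n x | x in J]|.

(** Along an [i]-face the neighbours of colours [j] and [k] alternate, so [fstep] matches the two
    sets. *)
Lemma edges_face J i j k : (forall x, J (f x) = J x) -> vertex_col_spec i j k ->
  edges J i j = edges J i k.
Proof.
move=> Jf ijk; rewrite /edges -[RHS](card_preimset _ f_inj); apply: eq_card => x.
rewrite !inE Jf col_face; case: (J x) => //=.
rewrite -(col_n (f x)) -[col x]col_face.
by case: (vertex_colP (a x)) => /=; case: ijk; rewrite ?eqxx ?colF.
Qed.

Lemma edges_sym i j : edges predT i j = edges predT j i.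
Proof.
rewrite /edges -[RHS](card_preimset _ a_inj); apply: eq_card => x.
by rewrite !inE aK /= andbC.
Qed.

Lemma card_darts : #|D| = 6 * edges predT 1 q.
Proof.
have e1 : edges predT 1 p = edges predT 1 q by apply: edges_face => //; constructor.
have e2 : edges predT p 1 = edges predT p q by apply: edges_face => //; constructor.
have e3 : edges predT q 1 = edges predT q p by apply: edges_face => //; constructor.
have s1 := edges_sym 1 p; have s2 := edges_sym 1 q; have s3 := edges_sym p q.
suff -> : #|D| = edges predT 1 p + edges predT 1 q + edges predT p 1
    + edges predT p q + edges predT q 1 + edges predT q p by lia.
rewrite -sum1_card /edges -!sum1dep_card !(big_mkcond (fun x => [&& predT x, _ & _])).
rewrite -!big_split; apply: eq_bigr => x _ /=; rewrite -!col_n.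
by case: (vertex_colP x); rewrite ?eqxx ?colF.
Qed.

Lemma card_vertices : #|D| = nvertices n * 3.
Proof.
rewrite -cardsT (card_classes_uniform (cl := vorb n) (k := 3)).
- by congr (_ * _); apply: eq_card => A; apply/imsetP/imsetP=> -[x _ ->]; exists x.
- by move=> x; rewrite inE connect0.
- by move=> x y; rewrite inE => c; apply/eqP; rewrite eq_sym
    (comp_of_eqE (fconnect_sym n_inj)).
- move=> x _; split; first exact: subsetT.
  have -> : vorb n x = [set y in setT | fconnect n x y] by apply/setP=> y; rewrite !inE.
  by rewrite card_vertex !inE.
Qed.

Lemma nfaces_split (J : pred D) : (forall x, J (f x) = J x) ->
  nfaces a n = nfaces_in J + nfaces_in (fun x => ~~ J x).
Proof.
move=> Jf; rewrite /nfaces /nfaces_in -cardsUI.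
rewrite [X in _ = _ + #|pred_of_set X|](_ : _ = set0) ?cards0 ?addn0.
  apply: eq_card => A; rewrite inE; apply/imsetP/orP=> [[x _ ->]|].
    by case Jx: (J x); [left|right]; apply: imset_f; rewrite // -topredE /= Jx.
  by case=> /imsetP[x _ ->]; exists x.
apply/setP=> A; rewrite !inE; apply/negP=> /andP[/imsetP[x Jx ->] /imsetP[y Jy]].
move=> /eqP; rewrite faceE => /(I_fconnect Jf) E.
by move: Jx Jy; rewrite -!topredE /= E => ->.
Qed.

(** With [m] edges between 1- and [q]-faces there are [2m] vertices and [3m] edges, hence [m + 2]
    faces; inside [I] the 1-[q] edges are traded for 1-[p] edges by alternation. *)
Lemma euler_region (I : pred D) : region I -> is_plane a n ->
  nfaces_in I + nfaces_in (fun x => ~~ I x) = edges I 1 p + edges (fun x => ~~ I x) 1 q + 2.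
Proof.
move=> [If _ _]; rewrite /is_plane (nfaces_split If) /nedges.
have -> : edges I 1 p = edges I 1 q by apply: edges_face => //; constructor.
have -> : edges I 1 q + edges (fun x => ~~ I x) 1 q = edges predT 1 q.
  rewrite /edges -cardsUI [X in _ + #|pred_of_set X|](_ : _ = set0) ?cards0 ?addn0.
    by apply: eq_card => x; rewrite !inE /=; case: (I x); rewrite /= ?orbF.
  by apply/setP=> x; rewrite !inE; case: (I x); rewrite ?andbF.
move: card_vertices; rewrite card_darts (_ : 6 * _ = 3 * edges predT 1 q * 2); last by lia.
rewrite mulnK //.
by move: (nfaces_in _) (nfaces_in _) (edges _ _ _) (nvertices _); lia.
Qed.

(** * The graph obtained by contracting the [p]-faces *)

Lemma p_colour : [|| p == 1, p == p | p == q]. Proof. by rewrite eqxx orbT. Qed.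

Lemma kept_pE x : kept a col p x = (col (n (n x)) == p).
Proof. by rewrite kept_col // p_colour. Qed.

Lemma kept_pa x : kept a col p (a x) = kept a col p x.
Proof. by rewrite /kept aK andbC. Qed.

Lemma kept_p_turn x : kept a col p (turn x) = kept a col p x.
Proof. by rewrite !kept_pE /turn n3 -col_n. Qed.

Lemma ncon_pE x : kept a col p x -> ncon a n col p x = turn x.
Proof. by move=> kx; rewrite nconE // p_colour. Qed.

(** At each vertex of a [p]-face one dart [y] leads away from it, and [n (n y)] is the dart of the
    face there. *)
Definition pvertex z : {set D} := [set y | n (n y) \in forb a n z].
Definition pface x : {set D} := [set y in forb a n x | kept a col p y].

Lemma cvertE x : kept a col p x -> cvert a n col p x = pvertex (n (n x)).
Proof.
move=> kx; apply/setP=> y; rewrite !inE; apply/idP/idP=> c.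
  suff /andP[] : kept a col p y && fconnect f (n (n x)) (n (n y)) by [].
  apply: (connect_ind (P := fun y => kept a col p y && fconnect f (n (n x)) (n (n y))) _ c);
    last by rewrite kx connect0.
  move=> u v /eqP <- /andP[ku xu]; rewrite ncon_pE // kept_p_turn ku /=.
  by rewrite (same_fconnect1_r f_inj) /turn n3 f_a.
rewrite (fconnect_sym f_inj) in c; have kc := fconnect_col c.
suff [_] : kept a col p (n (n (n x))) /\ fconnect (ncon a n col p) (n (n (n x))) y.
  by rewrite n3.
have ky : kept a col p y by rewrite kept_pE -kc -kept_pE.
apply: (connect_ind
  (P := fun w => kept a col p (n w) /\ fconnect (ncon a n col p) (n w) y) _ c); last first.
  by rewrite n3 ky connect0.
move=> u v /eqP <- [ku uy]; have E : turn (n (f u)) = n u by rewrite /turn /fstep n3 aK.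
have kv : kept a col p (n (f u)) by rewrite -kept_p_turn E.
by split=> //; apply: connect_trans uy; rewrite -E -ncon_pE // fconnect1.
Qed.

Lemma kept_p_f x : kept a col p x -> kept a col p (f x) = false.
Proof.
rewrite !kept_pE n3 -col_n => /eqP E; have /and3P[_ + _] := col_vertex x.
by rewrite E eq_sym => /negPf.
Qed.

(** Kept and contracted edges alternate along such a face, so one step in the reduced graph is two
    steps of [fstep]. *)
Lemma cfaceE x : kept a col p x -> cface a n col p x = pface x.
Proof.
move=> kx; apply/setP=> y; rewrite !inE.
have step u : kept a col p u -> ncon a n col p (a u) = f (f u).
  by move=> ku; rewrite ncon_pE ?kept_pa.
have kff u : kept a col p u -> kept a col p (f (f u)).
  by move=> ku; rewrite -step // ncon_pE ?kept_p_turn kept_pa.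
apply/idP/andP=> [c|[c ky]].
  apply: (connect_ind (P := fun y => fconnect f x y /\ kept a col p y) _ c) => //.
  by move=> u v /eqP <- [xu ku]; rewrite step // kff // -!(same_fconnect1_r f_inj).
suff [[]|[u ku [fu _]]] : (kept a col p y /\ fconnect (fun z => ncon a n col p (a z)) x y) \/
    exists2 u, kept a col p u & f u = y /\ fconnect (fun z => ncon a n col p (a z)) x u.
- by [].
- by move: ky; rewrite -fu kept_p_f.
apply: (connect_ind (P := fun y =>
    (kept a col p y /\ fconnect (fun z => ncon a n col p (a z)) x y) \/
    exists2 u, kept a col p u & f u = y /\ fconnect (fun z => ncon a n col p (a z)) x u) _ c);
  last by left.
move=> u v /eqP <- [[ku xu]|[w kw [<- xw]]]; first by right; exists u.
left; split; first exact: kff.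
by apply: connect_trans xw _; rewrite -step // fconnect1.
Qed.

Lemma mem_forb x : x \in forb a n x. Proof. by rewrite inE connect0. Qed.

Lemma forb_f x : forb a n (f x) = forb a n x.
Proof. by apply/eqP; rewrite faceE (fconnect_sym f_inj) fconnect1. Qed.

Lemma pface_f x : pface (f x) = pface x.
Proof. by rewrite /pface forb_f. Qed.

Lemma pvertex_eq x y : (pvertex x == pvertex y) = (forb a n x == forb a n y).
Proof.
apply/eqP/eqP=> [/setP/(_ (n y))|E]; last by rewrite /pvertex E.
by rewrite !inE n3 connect0 => c; apply/eqP; rewrite faceE.
Qed.

Lemma pface_kept x : col x = 1 -> exists2 y, y \in forb a n x & kept a col p y.
Proof.
move=> x1; case kx: (kept a col p x); first by exists x; rewrite ?mem_forb.
exists (f x); first by rewrite inE fconnect1.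
by move: kx; rewrite !kept_pE n3 -col_n; case: (vertex_colP x) x1; rewrite ?eqxx; colour_cases.
Qed.

Lemma pface_eq x y : col x = 1 -> col y = 1 ->
  (pface x == pface y) = (forb a n x == forb a n y).
Proof.
move=> x1 y1; apply/eqP/eqP=> [E|E]; last by rewrite /pface E.
have [z zx kz] := pface_kept x1; have : z \in pface x by rewrite inE zx.
rewrite E inE => /andP[zy _]; move: zx zy; rewrite !inE => zx zy.
by apply/eqP; rewrite faceE; apply: connect_trans zx _; rewrite fconnect_sym //; apply: f_inj.
Qed.

(** A common dart marks a vertex where the 1-face and the [p]-face meet, and there they share an
    edge. *)
Lemma radj_faces x z : col x = 1 -> col z = p ->
  reflect (exists2 y, fconnect f x y & fconnect f z (a y)) (pvertex z :&: pface x != set0).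
Proof.
move=> x1 zp; apply: (iffP (set0Pn _)) => [[w]|[y xy zy]].
  rewrite !inE => /andP[zw /andP[xw kw]]; exists (a (n (n w))); last by rewrite aK.
  by rewrite (same_fconnect1_r f_inj) f_a n3.
exists (f y); rewrite !inE -(same_fconnect1_r f_inj) xy n3 zy /=.
by rewrite kept_pE n3 (fconnect_col zy) zp.
Qed.

(** * The radial graph of a region *)

Definition face_node x : {set D} + {set D} :=
  if col x == p then inl (pvertex x) else inr (pface x).

Definition region_nodes (I : pred D) := [set face_node x | x in I].

Definition node_rel (W : {set {set D} + {set D}}) : rel ({set D} + {set D}) :=
  fun u w => [&& u \in W, w \in W & @radj D u w].

Lemma region_col I x : region I -> I x -> col x = 1 \/ col x = p.
Proof.
move=> [_ _ Iq] Ix; case/or3P: (col_cases x) => /eqP E; [by left|by right|].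
by rewrite (negPf (Iq _ E)) in Ix.
Qed.

Lemma face_node_p x : col x = p -> face_node x = inl (pvertex x).
Proof. by rewrite /face_node => ->; rewrite eqxx. Qed.

Lemma face_node_1 x : col x = 1 -> face_node x = inr (pface x).
Proof. by rewrite /face_node => ->; rewrite colF. Qed.

Lemma face_node_eq I x y : region I -> I x -> I y ->
  (face_node x == face_node y) = (forb a n x == forb a n y).
Proof.
move=> rI Ix Iy.
case: (region_col rI Ix) => cx; case: (region_col rI Iy) => cy.
- by rewrite (face_node_1 cx) (face_node_1 cy) -pface_eq.
- rewrite (face_node_1 cx) (face_node_p cy); apply/esym/negP; rewrite faceE => /fconnect_col.
  by rewrite cx cy => /eqP; rewrite colF.
- rewrite (face_node_p cx) (face_node_1 cy); apply/esym/negP; rewrite faceE => /fconnect_col.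
  by rewrite cx cy => /eqP; rewrite colF.
- by rewrite (face_node_p cx) (face_node_p cy) -pvertex_eq.
Qed.

Lemma card_region_nodes I : region I -> #|region_nodes I| = nfaces_in I.
Proof.
by move=> rI; apply: card_imset_eq_fibers => x y Ix Iy; apply: face_node_eq rI Ix Iy.
Qed.

Definition node_edge y : ({set D} + {set D}) * ({set D} + {set D}) :=
  (inl (pvertex (a y)), inr (pface y)).

(** A set of pairs, so parallel edges are merged and its size may fall below [edges I 1 p]. *)
Definition region_edges (I : pred D) :=
  [set node_edge y | y in [set x | [&& I x, col x == 1 & col (a x) == p]]].

Lemma region_edges_oriented I : oriented (enum (region_edges I)).
Proof.
split=> [|u v]; first exact: enum_uniq.
rewrite !mem_enum => /imsetP[y _ [-> ->]]; apply/negP=> /imsetP[z _ E].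
by case: E.
Qed.

Lemma edge_rel_region I : region I ->
  edge_rel (enum (region_edges I)) =2 node_rel (region_nodes I).
Proof.
move=> rI; have [If Ip Iq] := rI.
have sym W u v : node_rel W u v = node_rel W v u.
  by rewrite /node_rel andbCA; case: u => X; case: v => Y.
have to u v : (u, v) \in region_edges I -> node_rel (region_nodes I) u v.
  case/imsetP=> y; rewrite inE => /and3P[Iy /eqP y1 /eqP yp] [-> ->].
  apply/and3P; split.
  - by rewrite -face_node_p //; apply: imset_f; apply: Ip.
  - by rewrite -face_node_1 //; apply: imset_f.
  - by apply/radj_faces => //; exists y; apply: connect0.
have from X Y : node_rel (region_nodes I) (inl X) (inr Y) -> (inl X, inr Y) \in region_edges I.
  case/and3P=> /imsetP[z Iz Ez] /imsetP[x Ix Ex] /= XY.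
  have zp : col z = p by case: (region_col rI Iz) => // z1; rewrite face_node_1 in Ez.
  have x1 : col x = 1 by case: (region_col rI Ix) => // xp; rewrite face_node_p in Ex.
  rewrite face_node_p // in Ez; rewrite face_node_1 // in Ex.
  case: Ez Ex XY => -> [->] /(radj_faces x1 zp)[y xy zy].
  have -> : pvertex z = pvertex (a y) by apply/eqP; rewrite pvertex_eq faceE.
  have y1 : col y = 1 by rewrite (fconnect_col xy).
  have -> : pface x = pface y by apply/eqP; rewrite pface_eq // faceE.
  apply: (imset_f node_edge); rewrite inE (I_fconnect If xy) (Ix : I x) y1 eqxx.
  by rewrite (fconnect_col zy) zp eqxx.
move=> u v; rewrite /edge_rel !mem_enum; apply/orP/idP=> [[/to //|/to]|].
  by rewrite sym.
case: u => X; case: v => Y; first by case/and3P.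
- by move/from; left.
- by rewrite sym => /from; right.
- by case/and3P.
Qed.

Lemma region_nodes_neq0 (I : pred D) x : I x -> region_nodes I != set0.
Proof. by move=> Ix; apply/set0Pn; exists (face_node x); apply: imset_f. Qed.

Lemma region_tree_count I x : region I -> I x ->
  {in region_nodes I &, forall u v, connect (node_rel (region_nodes I)) u v} ->
  nfaces_in I <= #|region_edges I|.+1 /\
  (acyclic (node_rel (region_nodes I)) <-> nfaces_in I = #|region_edges I|.+1).
Proof.
move=> rI Ix cW; have eE := edge_rel_region rI.
have [] := tree_edge_count (region_nodes_neq0 Ix) (region_edges_oriented I).
- by move=> u v; rewrite eE => /and3P[].
- by move=> u v uW vW; rewrite (eq_connect eE); apply: cW.
rewrite card_region_nodes // -cardE => h1 h2; split=> //; rewrite -h2.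
by split=> h s us ss; have := h s us ss; rewrite (eq_cycle eE).
Qed.

(** Inner faces reach each other across non-boundary edges, and such an edge lies between a 1-face
    and a [p]-face. *)
Lemma region_nodes_connected I : region I -> connected_boundary I ->
  {in region_nodes I &, forall u v, connect (node_rel (region_nodes I)) u v}.
Proof.
move=> rI cI _ _ /imsetP[x Ix ->] /imsetP[y Iy ->]; have [If Ip Iq] := rI.
have := connected_boundary_same_side If cI Ix Iy => c.
suff /andP[] : I y && connect (node_rel (region_nodes I)) (face_node x) (face_node y) by [].
apply: (connect_ind (P := fun y => I y &&
  connect (node_rel (region_nodes I)) (face_node x) (face_node y)) _ c); last first.
  by rewrite connect0 andbT.
move=> u v uv /andP[Iu xu].
have Iv : I v.
  by case/orP: uv => [/andP[+ /eqP->]|/eqP->]; rewrite ?If // inE negbK => /eqP <-.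
rewrite Iv; case/orP: uv => [/andP[_ /eqP E]|/eqP E]; last first.
  have -> : face_node v = face_node u.
    by apply/eqP; rewrite (face_node_eq rI) // E forb_f.
  by [].
rewrite E in Iv *; apply: connect_trans xu (connect1 _).
rewrite -edge_rel_region // /edge_rel !mem_enum.
case: (region_col rI Iu) => cu; case: (region_col rI Iv) => cv.
- by have := col_edge u; rewrite cu cv eqxx.
- apply/orP; right; rewrite (face_node_1 cu) (face_node_p cv).
  by apply: (imset_f node_edge); rewrite inE Iu cu cv !eqxx.
- apply/orP; left; rewrite (face_node_p cu) (face_node_1 cv).
  rewrite -{1}(aK u); apply: (imset_f node_edge).
  by rewrite inE Iv aK cu cv !eqxx.
- by have := col_edge u; rewrite cu cv eqxx.
Qed.

Lemma region_face_bound I x : region I -> I x -> connected_boundary I ->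
  nfaces_in I <= (edges I 1 p).+1.
Proof.
move=> rI Ix cI; have [le _] := region_tree_count rI Ix (region_nodes_connected rI cI).
by apply: leq_trans le _; rewrite ltnS leq_imset_card.
Qed.

Lemma spanning_nodes I T : region I ->
  T = [set pface x | x in [pred x | I x && (col x == 1)]] ->
  [set inl X | X in cvertices a n col p] :|: [set inr F | F in T] = region_nodes I.
Proof.
move=> rI ->; have [If Ip Iq] := rI; apply/setP=> u; rewrite inE; apply/orP/imsetP.
  case=> /imsetP[A].
    case/imsetP=> x kx -> ->; exists (n (n x)).
      by apply: Ip; apply/eqP; rewrite -kept_pE.
    by rewrite face_node_p ?cvertE //; apply/eqP; rewrite -kept_pE.
  case/imsetP=> x /andP[Ix /eqP x1] -> ->; exists x => //.
  by rewrite face_node_1.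
case=> x Ix ->; case: (region_col rI Ix) => cx.
  right; rewrite face_node_1 //; apply: imset_f; apply: imset_f.
  by rewrite inE (Ix : I x) cx eqxx.
left; rewrite face_node_p //; apply: imset_f; apply/imsetP; exists (n x).
  by rewrite -topredE /= kept_pE n3 cx.
by rewrite cvertE ?n3 // kept_pE n3 cx.
Qed.

Lemma spanning_tree_of_region I x0 : region I -> I x0 -> is_plane a n ->
  connected_boundary I -> nfaces_in (fun x => ~~ I x) <= (edges (fun x => ~~ I x) 1 q).+1 ->
  exists T : {set {set D}},
    (forall F, F \in T -> from_1face col F) /\ spanning_tree_of_faces a n col p T.
Proof.
move=> rI Ix0 plane cI out; pose T := [set pface x | x in [pred x | I x && (col x == 1)]].
exists T; split; last split.
- move=> _ /imsetP[x /andP[_ /eqP x1] ->] y; rewrite !inE => /andP[xy _].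
  by rewrite (fconnect_col xy).
- apply/subsetP=> _ /imsetP[x /andP[_ /eqP x1] ->].
  have [y yx ky] := pface_kept x1; apply/imsetP; exists y => //.
  have E : forb a n x = forb a n y by apply/eqP; rewrite faceE; rewrite inE in yx.
  by rewrite cfaceE // /pface E.
rewrite /is_tree (spanning_nodes rI (erefl T)).
have cW := region_nodes_connected rI cI; split=> // {cI}.
have [le acyc] := region_tree_count rI Ix0 cW; apply/acyc.
(* [out] bounds the other side, so Euler's formula makes all these inequalities equalities, this one
   included: no edges were merged. *)
have leE : #|region_edges I| <= edges I 1 p by apply: leq_imset_card.
have := euler_region rI plane; move: le leE out.
move: (nfaces_in _) (nfaces_in _) #|region_edges I| (edges _ _ _) (edges _ _ _).
by lia.
Qed.

(** * The ribbon graph of a region *)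

Section InnerPermutations.
Variables (I : pred D).
Hypothesis rI : region I.
Let If : forall x, I (f x) = I x. Proof. by case: rI. Qed.

(** Inner faces become the vertices of the ribbon graph, with rotation [inner_face] and edge
    involution [inner_edge]; darts outside [I] are fixed. *)
Definition inner_face x := if I x then f x else x.
Definition inner_edge x := if I x && I (a x) then a x else x.

Lemma inner_face_inj : injective inner_face.
Proof.
rewrite /inner_face => x y; case Ix: (I x); case Iy: (I y) => // E.
- exact: f_inj.
- by rewrite -E If Ix in Iy.
- by rewrite E If Iy in Ix.
Qed.

Lemma inner_edgeK : involutive inner_edge.
Proof.
move=> x; rewrite /inner_edge; case Ix: (I x); case Iax: (I (a x));
  by rewrite /= ?aK ?Ix ?Iax.
Qed.

Definition face_perm := perm inner_face_inj.
Definition edge_perm := perm (can_inj inner_edgeK).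

Lemma face_perm_in x : I x -> face_perm x = f x.
Proof. by move=> Ix; rewrite permE /inner_face Ix. Qed.

Lemma face_perm_out x : ~~ I x -> face_perm x = x.
Proof. by move=> /negPf Ix; rewrite permE /inner_face Ix. Qed.

Lemma edge_perm_out x : ~~ I x -> edge_perm x = x.
Proof. by move=> /negPf Ix; rewrite permE /inner_edge Ix. Qed.

Lemma I_face_perm x : I (face_perm x) = I x.
Proof. by rewrite permE /inner_face; case: ifP => //; rewrite If. Qed.

Lemma I_edge_perm x : I (edge_perm x) = I x.
Proof. by rewrite permE /inner_edge; case: ifP => // /andP[-> ->]. Qed.

Lemma card_porbits_split (s : {perm D}) :
  (forall x, I (s x) = I x) -> (forall x, ~~ I x -> s x = x) ->
  #|porbits s| = #|[set porbit s x | x in I]| + #|[pred x | ~~ I x]|.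
Proof.
move=> sI s1; apply: card_classes_split.
- exact: porbit_id.
- by move=> x nx; rewrite porbit_invol !s1 // setUid.
- move=> x y Ix; rewrite porbit_fconnect => c.
  by apply: (connect_ind (P := I) _ c) => // u v /eqP <-; rewrite sI.
Qed.

Lemma card_face_perm : #|porbits face_perm| = nfaces_in I + #|[pred x | ~~ I x]|.
Proof.
rewrite card_porbits_split; [|exact: I_face_perm|exact: face_perm_out].
congr (_ + _); congr #|pred_of_set _|; apply: eq_in_imset => x Ix.
apply/setP=> y; rewrite inE porbit_fconnect; apply/idP/idP=> c.
  suff /andP[] : I y && fconnect f x y by [].
  apply: (connect_ind (P := fun y => I y && fconnect f x y) _ c); last first.
    by rewrite (Ix : I x) connect0.
  move=> u v /eqP <- /andP[Iu xu].
  by rewrite I_face_perm Iu face_perm_in // -(same_fconnect1_r f_inj).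
suff /andP[] : I y && fconnect face_perm x y by [].
apply: (connect_ind (P := fun y => I y && fconnect face_perm x y) _ c); last first.
  by rewrite (Ix : I x) connect0.
move=> u v /eqP <- /andP[Iu xu].
by rewrite If Iu -face_perm_in // -(same_fconnect1_r perm_inj).
Qed.

(** The moved darts are those of the 1-[p] edges inside [I], and each swapped pair costs one
    orbit. *)
Lemma card_edge_perm : #|porbits edge_perm| + edges I 1 p = #|D|.
Proof.
have epK x : edge_perm (edge_perm x) = x by rewrite !permE inner_edgeK.
have := card_porbits_invol epK; set M := [set x | _].
suff -> : #|M| = (edges I 1 p).*2 by move: #|porbits _| (edges _ _ _) #|D|; lia.
pose A := [set x | [&& I x, col x == 1 & col (a x) == p]].
have [_ Ip _] := rI.
have -> : M = A :|: a @^-1: A.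
  apply/setP=> x; rewrite !inE permE /inner_edge aK.
  case Ix: (I x); case Iax: (I (a x)) => /=; rewrite ?eqxx.
  - rewrite a_neq; have := col_edge x.
    by case: (region_col rI Ix) => ->; case: (region_col rI Iax) => ->; rewrite ?eqxx ?orbT.
  - by apply/esym/negP; rewrite orbF => /andP[_ /eqP/Ip]; rewrite Iax.
  - by apply/esym/negP=> /andP[_ /eqP/Ip]; rewrite Ix.
  - by [].
rewrite cardsU card_preimset; last exact: a_inj.
rewrite disjoint_setI0 ?cards0; last first.
  rewrite disjoint_subset; apply/subsetP=> x; rewrite !inE => /and3P[_ /eqP x1 _].
  by rewrite aK x1 colF !andbF.
by rewrite subn0 addnn.
Qed.

Lemma connected_boundary_of_count x0 : I x0 ->
  (forall x y, I x -> I y -> connect (perm2_rel face_perm edge_perm) x y) ->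
  nfaces_in I = (edges I 1 p).+1 -> connected_boundary I.
Proof.
move=> Ix0 conn cnt; pose w := (edge_perm * face_perm)%g.
have wI x : I (w x) = I x by rewrite permM I_face_perm I_edge_perm.
have nc : ncomp (perm2_rel face_perm edge_perm) = 1 + #|[pred x | ~~ I x]|.
  rewrite /ncomp (card_classes_split (I := I)).
  - congr (_ + _).
    rewrite (_ : [set _ | x in _] = [set comp_of (perm2_rel face_perm edge_perm) x0]) ?cards1 //.
    apply/setP=> A; rewrite inE; apply/imsetP/eqP=> [[x Ix ->]|->]; last by exists x0.
    by apply/eqP; rewrite comp_of_eqE; [apply: conn|apply: perm2_csym].
  - exact: comp_of_refl.
  - move=> x nIx; apply/setP=> y; rewrite !inE; apply/idP/eqP=> [c|->]; last exact: connect0.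
    apply: (connect_ind (P := fun y => y = x) _ c) => // u v uv E; move: uv.
    by rewrite E /perm2_rel face_perm_out // edge_perm_out // orbb => /eqP.
  - move=> x y Ix; rewrite inE => c; apply: (connect_ind (P := I) _ c) => // u v.
    by case/orP=> /eqP->; rewrite ?I_face_perm ?I_edge_perm.
(* With [o] darts outside, [e] inner edges and [k] orbits of [w] inside, the inequality reads [(e +
   1 + o) + (#|D| - e) + (k + o) <= #|D| + 2 (1 + o)]. *)
have k1 : #|[set porbit w x | x in I]| <= 1.
  have := euler_inequality face_perm edge_perm; rewrite -/w nc card_face_perm.
  rewrite (card_porbits_split (s := w)) //; last first.
    by move=> x nx; rewrite permM edge_perm_out // face_perm_out.
  have := card_edge_perm; rewrite cnt.
  move: #|porbits edge_perm| (edges _ _ _) #|[pred x | ~~ I x]| #|D|.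
  by move: #|[set porbit w x | x in I]|; lia.
(* At an inner edge [w] turns around the vertex, at a boundary edge it moves along it: its orbits
   inside are the boundary walks. *)
have inner x y : I x -> I y -> connect (cycle_step (boundary I)) x y.
  move=> Ix Iy.
  have : porbit w x = porbit w y.
    by have /card_le1_eqP := k1; apply; apply: imset_f.
  move=> E; have : y \in porbit w x by rewrite E porbit_id.
  rewrite porbit_fconnect => c.
  suff /andP[] : I y && connect (cycle_step (boundary I)) x y by [].
  apply: (connect_ind (P := fun y => I y && connect (cycle_step (boundary I)) x y) _ c);
    last by rewrite Ix connect0.
  move=> u v /eqP <- /andP[Iu xu]; rewrite wI Iu; apply: connect_trans xu _.
  rewrite permM face_perm_in ?I_edge_perm // permE /inner_edge Iu /=.
  case Iau: (I (a u)); first by rewrite f_a connect1 // /cycle_step eqxx orbT.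
  apply: (@connect_trans _ _ (a u)); rewrite connect1 // /cycle_step ?eqxx ?orbT //.
  by rewrite inE Iu Iau.
have [_ Ip _] := rI.
move=> x y; have [v vx /Ip Iv] := vertex_col x p_colour.
have [v' vy /Ip Iv'] := vertex_col y p_colour.
apply: connect_trans (proj1 (cycle_step_vertex _ vx)) _.
exact: connect_trans (inner _ _ Iv Iv') (proj2 (cycle_step_vertex _ vy)).
Qed.

End InnerPermutations.

Lemma region_of_spanning_tree (x0 : D) (T : {set {set D}}) :
  is_plane a n -> (forall u v, connect (fun s t => (t == a s) || (t == n s)) u v) ->
  three_connected a n -> (forall u, ~~ fconnect n u (a u)) ->
  (forall F, F \in T -> from_1face col F) -> spanning_tree_of_faces a n col p T ->
  exists2 I, region I & connected_boundary I.
Proof.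
move=> plane conn conn3 loopless T1 [sT tree].
pose I x := (col x == p) || (col x == 1) && (pface x \in T).
have If x : I (f x) = I x by rewrite /I col_face pface_f.
have rI : region I.
  by split=> // x cx; rewrite /I cx ?eqxx // !colF.
exists I => //.
have ET : T = [set pface x | x in [pred x | I x && (col x == 1)]].
  apply/setP=> F; apply/idP/imsetP=> [FT|[x /andP[Ix /eqP x1] ->]]; last first.
    by move: Ix; rewrite /I x1 colF eqxx.
  have /imsetP[x kx EF] := subsetP sT F FT; rewrite cfaceE // in EF.
  have x1 : col x = 1 by apply: (T1 F FT); rewrite EF !inE connect0.
  by exists x; rewrite // inE /I x1 eqxx -EF FT orbT.
move: tree; rewrite /is_tree (spanning_nodes rI ET) => -[cW acyc].
have [xp _ xpc] := vertex_col x0 p_colour.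
have Ixp : I xp by rewrite /I xpc eqxx.
have [_ [/(_ acyc) cnt _]] := region_tree_count rI Ixp cW.
apply: (connected_boundary_of_count (rI := rI) Ixp); last first.
  (* [node_edge] is injective on the inner 1-[p] edges, so the tree has as many edges as the ribbon
     graph. *)
  rewrite cnt card_in_imset // => x y; rewrite !inE => /and3P[Ix /eqP x1 /eqP cx].
  move=> /and3P[Iy /eqP y1 /eqP cy] [/eqP E1 /eqP E2].
  apply: faces_share_one_edge => //; rewrite -faceE.
    by rewrite -pface_eq.
  by rewrite -pvertex_eq.
set e := perm2_rel _ _.
have same x y : I x -> fconnect f x y -> connect e x y.
  move=> Ix c; suff /andP[] : I y && connect e x y by [].
  apply: (connect_ind (P := fun y => I y && connect e x y) _ c); last first.
    by rewrite Ix connect0.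
  move=> u v /eqP <- /andP[Iu xu]; rewrite If Iu; apply: connect_trans xu (connect1 _).
  by rewrite /e /perm2_rel face_perm_in // eqxx.
move=> x y Ix Iy.
(* Lifts a path of the radial graph to the darts: all darts of the face at node [u] are
   reachable. *)
pose P u := forall z, I z -> face_node z = u -> connect e x z.
suff : P (face_node y) by apply.
have := cW _ _ (imset_f face_node Ix) (imset_f face_node Iy) => c.
apply: (connect_ind (P := P) _ c); last first.
  move=> z Iz /eqP; rewrite (face_node_eq rI) // faceE => /(same _ _ Iz).
  by rewrite perm2_csym.
move=> u v; rewrite -[[&& _, _ & _]]/(node_rel (region_nodes I) u v) -edge_rel_region //.
have edge z : z \in [set x | [&& I x, col x == 1 & col (a x) == p]] ->
    [/\ I z, I (a z), face_node z = inr (pface z), face_node (a z) = inl (pvertex (a z))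
      & connect e z (a z)].
  rewrite inE => /and3P[Iz /eqP z1 /eqP zp]; have Iaz : I (a z) by rewrite /I zp eqxx.
  split=> //; [exact: face_node_1|exact: face_node_p|].
  by apply: connect1; rewrite /e /perm2_rel [edge_perm _ _]permE /inner_edge Iz Iaz eqxx orbT.
have fromto z z' t : I z -> I z' -> I t -> connect e z z' -> face_node t = face_node z' ->
    connect e x z -> connect e x t.
  move=> Iz Iz' It zz' /eqP; rewrite (face_node_eq rI) // faceE => /(same _ _ It) tz' xz.
  by apply: connect_trans xz (connect_trans zz' _); rewrite /e perm2_csym.
rewrite /edge_rel !mem_enum => /orP[]/imsetP[z /edge[Iz Iaz Ez Eaz zaz] [-> ->]] Pu t It Et.
  apply: (fromto (a z) z) => //; last exact: Pu.
    by rewrite /e perm2_csym.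
  by rewrite Et.
apply: (fromto z (a z)) => //; last exact: Pu.
by rewrite Et.
Qed.
End ColouredMap.

(** * The equivalences for the colours 2 and 3 *)

Lemma region_compl (D : finType) (a n : D -> D) (col : D -> nat) p q (I : pred D) :
  region a n col p q I -> region a n col q p (fun x => ~~ I x).
Proof. by case=> If Ip Iq; split=> x; [rewrite If | apply: Iq | rewrite negbK; apply: Ip]. Qed.

Theorem theorem2 (D : finType) (a n : D -> D) (col : D -> nat) (od : D) :
  is_map a n -> is_plane a n -> is_cubic n -> is_simple a n ->
  three_connected a n -> is_bipartite a n ->
  proper_face_3col a n col -> col od = 3 ->
  [<-> exists C : {set D}, good_ham_cycle a n col od C;
       exists s : seq D, A_trail a n col 1 s;
       exists T : {set {set D}},
         (forall F, F \in T -> from_1face col F) /\ spanning_tree_of_faces a n col 2 T;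
       exists T : {set {set D}},
         (forall F, F \in T -> from_1face col F) /\ spanning_tree_of_faces a n col 3 T].
Proof.
move=> [aK _ _ conn] plane cubic [loopless _] conn3 _ colP cod.
have n3 x : n (n (n x)) = x by case: (cubic x).
have col_f x : col (fstep a n x) = col x by case: (colP x).
have col_a x : col (a x) != col x by case: (colP x).
have c23 x : [|| col x == 1, col x == 2 | col x == 3].
  by case: (colP x) => + _ _; case: (col x) => [|[|[|[|]]]].
have c32 x : [|| col x == 1, col x == 3 | col x == 2].
  by move: (c23 x); rewrite [(_ == 2) || _]orbC.
(* The hub: (i), (ii) and (iii) are equivalent to [good 2 3], and (iv) to [good 3 2]. *)
pose good p q := exists2 I, region a n col p q I & connected_boundary a n I.
have swap p q : good p q -> good q p.
  by case=> I rI cI; exists (fun x => ~~ I x);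
    [apply: region_compl|apply: connected_boundary_compl].
have tree p q : (forall x, [|| col x == 1, col x == p | col x == q]) ->
    (forall x, [|| col x == 1, col x == q | col x == p]) ->
    [&& p != 1, q != 1 & p != q] -> [&& q != 1, p != 1 & q != p] ->
    good p q <-> exists T : {set {set D}},
      (forall F, F \in T -> from_1face col F) /\ spanning_tree_of_faces a n col p T.
  move=> cpq cqp npq nqp; split=> [[I rI cI]|[T [T1 tT]]]; last first.
    exact: (region_of_spanning_tree aK n3 col_f col_a cpq npq od plane conn conn3 _ T1 tT).
  have [_ Ip Iq] := rI; have ppq : [|| p == 1, p == p | p == q] by rewrite eqxx orbT.
  have qqp : [|| q == 1, q == q | q == p] by rewrite eqxx orbT.
  have [x _ xp] := vertex_col aK n3 col_f col_a cpq od ppq.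
  have [y _ yq] := vertex_col aK n3 col_f col_a cqp od qqp.
  apply: (spanning_tree_of_region aK n3 col_f col_a cpq npq rI (Ip x xp) plane cI).
  exact: (region_face_bound aK n3 col_f col_a cqp nqp (region_compl rI) (Iq y yq)
    (connected_boundary_compl cI)).
have ham : good 2 3 <-> exists C, good_ham_cycle a n col od C.
  exact: iff_sym (separating_ham_cycleP aK n3 col_f col_a c23 cod).
have trail : good 2 3 <-> exists s, A_trail a n col 1 s.
  split=> [[I rI cI]|[s sT]].
    exact: (A_trail_of_region aK n3 col_f col_a c23 isT od rI cI).
  case: (A_trail_monochromatic aK n3 col_f col_a c23 isT sT) => sK.
    exact: (region_of_A_trail aK n3 col_f col_a c23 isT sT sK).
  (* A trail in the other direction is crossing once 2 and 3 are exchanged; complementing leads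
     back. *)
  apply/swap/(region_of_A_trail aK n3 col_f col_a c32 isT sT).
  by apply: sub_all sK => x /andP[ax]; rewrite aK /crossing ax andbT.
tfae.
- by move/ham/trail.
- by move/trail/(tree 2 3 c23 c32 isT isT).
- by move/(tree 2 3 c23 c32 isT isT)/swap/(tree 3 2 c32 c23 isT isT).
- by move/(tree 3 2 c32 c23 isT isT)/swap/ham.
Qed.
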